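(* For every integer $n\ge 1$ let $R=(R(t))_{t\ge 0}$ be the diffusion with $R(0)=0$ satisfying $dR(t)=\sqrt{2}\,dB(t)+b_n(R(t))\,dt$ up to the time $\tau_n=\inf\{t\ge 0: R(t)=\pi\}$. Then for any $r>0$, $$\lim_{n\to\infty}\mathbb{P}\left[\tau_n>(1+r)\frac{\ln(n)}{n}\right]=0,\qquad \lim_{n\to\infty}\mathbb{P}\left[\tau_n<(1-r)\frac{\ln(n)}{n}\right]=0.$$
   Context: Here $(B(t))_{t\ge 0}$ is a standard real Brownian motion and $b_n:(0,\pi)\to\mathbb{R}$ is given by $$b_n(r)=2\,\frac{\sin^n(r)}{\int_0^r\sin^n(u)\,du}-n\,\frac{\cos(r)}{\sin(r)},\qquad r\in(0,\pi).$$ As $r\to 0_+$ one has $b_n(r)\sim (n+2)/r$, so $0$ is an entrance boundary: the diffusion $R$ can be started at $0$ and never returns to $0$ at positive times. ($R(t)$ is the radius of a ball $D(t)$ of the sphere $\mathbb{S}^{n+1}$, where $D$ is a ball-valued dual process intertwined with the Brownian motion on $\mathbb{S}^{n+1}$ with generator the Laplacian, and $\tau_n$ is then a strong stationary time for this Brownian motion.) *)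

(* Defs.v *)
From HB Require Import structures.
From mathcomp Require Import all_boot all_order all_algebra.
From mathcomp Require Import all_classical all_reals all_analysis.

Set Implicit Arguments.
Unset Strict Implicit.
Unset Printing Implicit Defensive.

Import Order.TTheory GRing.Theory Num.Theory.
Import numFieldNormedType.Exports.

Local Open Scope classical_set_scope.
Local Open Scope ring_scope.

(* Processes and filtrations are indexed by all of R; only their values at
   times t >= 0 are ever constrained or used. *)

Section processes.
Context {R : realType} (d : measure_display) (T : measurableType d).
Implicit Types (P : probability T R) (F : R -> set (set T)) (X B : R -> T -> R).

Record filtration F : Prop := Filtration {
  filtration_sigma_algebra : forall t : R, 0 <= t -> sigma_algebra setT (F t) ;
  filtration_measurable : forall t : R, 0 <= t -> F t `<=` measurable ;
  filtration_mono : forall s t : R, 0 <= s -> s <= t -> F s `<=` F t }.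

Definition adapted F X : Prop :=
  forall t : R, 0 <= t -> forall A : set (measurableTypeR R), measurable A ->
    F t (X t @^-1` A).

Definition path_continuous (x : R -> R) : Prop :=
  {within [set t | 0 <= t], continuous x}.

(* The second argument of normal_prob is the standard deviation. *)
Record brownian_motion P F B : Prop := BrownianMotion {
  bm_adapted : adapted F B ;
  bm_start : {ae P, forall w, B 0 w = 0} ;
  bm_continuous : {ae P, forall w, path_continuous (B ^~ w)} ;
  bm_gaussian : forall s t : R, 0 <= s -> s < t ->
    forall A : set (measurableTypeR R), measurable A ->
      P ((fun w => B t w - B s w) @^-1` A)
      = normal_prob 0 (Num.sqrt (t - s)) A ;
  bm_independent : forall s t : R, 0 <= s -> s < t ->
    forall (D : set T) (A : set (measurableTypeR R)), F s D -> measurable A ->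
      P (D `&` (fun w => B t w - B s w) @^-1` A)
      = (P D * P ((fun w => B t w - B s w)%R @^-1` A))%E }.

(* The infimum is +oo when the level is never reached. *)
Definition hitting_time (a : R) X (w : T) : \bar R :=
  ereal_inf [set t%:E | t in [set t | 0 <= t /\ X t w = a]].

(* Meaningful for r in ]0, pi[ only. *)
Definition drift (n : nat) (r : R) : R :=
  2 * (sin r ^+ n / (\int[lebesgue_measure]_(u in `[0, r]) (sin u ^+ n))%R)
  - n%:R * (cos r / sin r).

Definition tau X : T -> \bar R := hitting_time pi X.

(* (F, B, X) is a weak solution, up to the hitting time of pi, of
     dX(t) = sqrt 2 dB(t) + b_n(X(t)) dt,  X(0) = 0.
   The noise being additive, the integrated equation involves only a pathwise
   Lebesgue integral.  The path lies in the domain ]0, pi[ of b_n at times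
   t in ]0, tau[; the value of the drift at the single time 0 is irrelevant.
   Paths of X are continuous everywhere (and not only almost surely) so that
   tau is a random variable without completing the probability space. No
   equation is imposed on X after tau. *)
Record dual_radius (n : nat) P F B X : Prop := DualRadius {
  dr_filtration : filtration F ;
  dr_brownian : brownian_motion P F B ;
  dr_adapted : adapted F X ;
  dr_continuous : forall w, path_continuous (X ^~ w) ;
  dr_start : {ae P, forall w, X 0 w = 0} ;
  dr_domain : {ae P, forall w (t : R), 0 < t -> (t%:E < tau X w)%E ->
    0 < X t w < pi} ;
  dr_integrable : {ae P, forall w (t : R), 0 <= t -> (t%:E < tau X w)%E ->
    lebesgue_measure.-integrable `[0, t] (fun s => (drift n (X s w))%:E)} ;
  dr_sde : {ae P, forall w (t : R), 0 <= t -> (t%:E < tau X w)%E ->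
    X t w = Num.sqrt 2 * B t w
            + (\int[lebesgue_measure]_(s in `[0, t]) drift n (X s w))%R} }.

End processes.

(* Main.v *)
Require Import Defs.
From HB Require Import structures.
From mathcomp Require Import all_boot all_order all_algebra.
From mathcomp Require Import all_classical all_reals all_analysis.
From mathcomp Require Import measurable_realfun ring lra.
Import Order.TTheory GRing.Theory Num.Theory.
Import numFieldNormedType.Exports.
Local Open Scope classical_set_scope.
Local Open Scope ring_scope.

(** The noise is additive, so the argument is pathwise: off an event of small
    probability the diffusion is a small perturbation of a differential
    equation, and no stochastic calculus is needed.

    Write L = ln n and let y = X - sqrt 2 B, which is differentiable on
    ]0, tau[ with y' = b_n(X) (lemma [is_derive_path]).  With e = r L / (24
    sqrt n) and H = (1 + r) L / n, the event that |sqrt 2 B| exceeds e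
    somewhere on [0, H] has, for n large, probability at most 4 exp(- c L) for
    a constant c > 0 depending on r only: [dyadic_sup_bound] bounds the supremum of the
    Brownian motion by the tail of a single increment (Ottaviani's inequality
    on dyadic grids, followed by a passage to the limit), and [normal_tail]
    bounds that tail.

    The drift is controlled by three estimates, with z = x - pi/2:
    b_n(x) >= n |z| ([drift_ge_dist]), b_n(x) >= sqrt n / 6
    ([drift_ge_sqrt]), and b_n(x) <= (1 + 5 d) n |z| as soon as
    4 / (d sqrt n) <= |z| and z^2 <= d <= 1 ([drift_le]).  They come from comparing
    the derivatives of the integral of sin^n and of sin^(n+1) / (n cos).

    Upper bound on tau ([path_reaches_pi]).  While X is below pi/2 the distance
    of y to pi/2 contracts at rate at least n, up to an error e, so after a time
    L / (2 n) it is of order e; the lower bound sqrt n / 6 makes y cross the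
    window of width 4 e around pi/2 within a time r L / n; then the distance
    expands at rate at least n and X reaches pi within a further time L / (2 n).  The
    total is (1 + r) L / n.

    Lower bound on tau ([path_time_ge]).  Between the levels
    pi/2 - (d - e) and pi/2 - 2 e, and again between pi/2 + 2 e and
    pi/2 + (d - e), the distance to pi/2 varies at rate at most (1 + 5 d) n.
    Both crossings together take at least
    (2 / ((1 + 5 d) n)) ln (d / (3 e)), which exceeds (1 - r) L / n for d = r/5
    and n large. *)

(** * The integral of the powers of the sine *)

Section calculus.
Context {R : realType}.
Implicit Types (a b x y : R) (n : nat).

(** Only the interior of the segment is constrained, which is what the endpoint
    singularities of the drift and of the path require. *)
Lemma is_derive_ge0_le (f df : R -> R) a b : a <= b ->
  (forall x, a < x < b -> is_derive x 1 f (df x)) ->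
  (forall x, a < x < b -> 0 <= df x) ->
  {within `[a, b], continuous f} -> f a <= f b.
Proof.
rewrite le_eqVlt => /predU1P[-> //|ab] fdf df0 cf.
have fdf' x : x \in `]a, b[%R -> is_derive x 1 f (df x).
  by rewrite in_itv/=; exact: fdf.
have [c cab e] := MVT ab fdf' cf.
by rewrite -subr_ge0 e mulr_ge0 ?subr_ge0 ?(ltW ab)//; apply: df0; move: cab; rewrite in_itv.
Qed.

Lemma sin_le y : 0 <= y -> sin y <= y.
Proof.
move=> y0; rewrite -subr_ge0.
have := @is_derive_ge0_le (fun x => x - sin x) (fun x => 1 - cos x) 0 y y0.
rewrite sin0 subrr; apply.
- by move=> x _; rewrite subr_ge0 cos_le1.
- by apply: continuous_subspaceT => x; apply: cvgB; [exact: cvg_id|exact: continuous_sin].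
Qed.

Lemma sin_ge_Mcos y : 0 <= y <= pi / 2 -> y * cos y <= sin y.
Proof.
move=> /andP[y0 y1]; rewrite -subr_ge0.
have := @is_derive_ge0_le (fun x => sin x - x * cos x) (fun x => x * sin x) 0 y y0.
rewrite sin0 mul0r subrr; apply.
- move=> x _; apply: is_derive_eq.
  by rewrite /GRing.scale/=; ring.
- move=> x /andP[x0 xy]; rewrite mulr_ge0 ?(ltW x0)// sin_ge0_pi// (ltW x0)/=.
  by move: (pi_gt0 R) => ?; lra.
- apply: continuous_subspaceT => x; apply: cvgB; first exact: continuous_sin.
  by apply: cvgM; [exact: cvg_id|exact: continuous_cos].
Qed.

Lemma cos_ge y : 1 - y ^+ 2 / 2 <= cos y.
Proof.
rewrite -(cos_norm y) -(real_normK (num_real y)).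
move: (`|y|) (normr_ge0 y) => z z0; rewrite -subr_ge0.
have := @is_derive_ge0_le (fun x => cos x - (1 - x ^+ 2 / 2)) (fun x => x - sin x) 0 z z0.
rewrite cos0 expr0n/= mul0r subr0 subrr; apply.
- move=> x _; apply: is_derive_eq.
  by rewrite /GRing.scale/=; field.
- by move=> x /andP[x0 _]; rewrite subr_ge0 sin_le// ltW.
- apply: continuous_subspaceT => x; apply: cvgB; first exact: continuous_cos.
  apply: cvgB; first exact: cvg_cst.
  by apply: cvgM; [exact: exprn_continuous|exact: cvg_cst].
Qed.

(** The denominator of the singular part of the drift. *)
Definition sinint n x : R := (\int[lebesgue_measure]_(u in `[0, x]) (sin u ^+ n))%R.

Lemma continuous_sinX n : continuous (fun x : R => sin x ^+ n).
Proof.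
move=> x; apply: (@continuous_comp _ _ _ (@sin R) (fun z => z ^+ n)).
  exact: continuous_sin.
exact: exprn_continuous.
Qed.

Lemma is_derive_sinX n x :
  is_derive x 1 (fun x : R => sin x ^+ n) (n%:R * sin x ^+ n.-1 * cos x).
Proof.
have -> : (fun x : R => sin x ^+ n) = (@sin R) ^+ n.
  by apply/funext => z; rewrite exprfctE.
exact: is_deriveX.
Qed.

Lemma integrable_sinX n b :
  lebesgue_measure.-integrable `[0, b] (EFin \o (fun x : R => sin x ^+ n)).
Proof.
apply: continuous_compact_integrable; first exact: segment_compact.
exact/continuous_subspaceT/continuous_sinX.
Qed.

Lemma is_derive_sinint n x : 0 < x -> is_derive x 1 (sinint n) (sin x ^+ n).
Proof.
move=> x0; have [] := @continuous_FTC1_closed R (fun u => sin u ^+ n) 0 x (x + 1).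
- by rewrite ltrDl.
- exact: integrable_sinX.
- by [].
- exact: continuous_sinX.
move=> d e; apply: DeriveDef; [exact: d|rewrite -derive1E; exact: e].
Qed.

Lemma sinint0 n : sinint n 0 = 0.
Proof. by rewrite /sinint set_itv1 Rintegral_set1. Qed.

Lemma within_continuous_sinint n a b : 0 <= a ->
  {within `[a, b], continuous (sinint n)}.
Proof.
move=> a0; have [ab|ba] := leP a b; last first.
  by rewrite set_itv_ge ?bnd_simp -?ltNge//; exact: continuous_subspace0.
apply: (continuous_subspaceW _ (parameterized_integral_continuous (le_trans a0 ab)
  (integrable_sinX n b))).
by apply: subset_itvr; rewrite bnd_simp.
Qed.

Lemma sinint_diff n a b : 0 <= a -> a < b ->
  exists2 c, a < c < b & sinint n b - sinint n a = sin c ^+ n * (b - a).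
Proof.
move=> a0 ab; have dI x : x \in `]a, b[%R -> is_derive x 1 (sinint n) (sin x ^+ n).
  rewrite in_itv/= => /andP[ax _]; apply: is_derive_sinint.
  exact: le_lt_trans ax.
have [c cab e] := MVT ab dI (within_continuous_sinint n a b a0).
by exists c => //; move: cab; rewrite in_itv.
Qed.

Lemma sinint_gt0 n x : 0 < x < pi -> 0 < sinint n x.
Proof.
move=> /andP[x0 xpi]; have [c /andP[c0 cx]] := sinint_diff n 0 x (lexx 0) x0.
rewrite sinint0 !subr0 => ->; rewrite mulr_gt0// exprn_gt0// sin_gt0_pi// c0/=.
exact: lt_trans xpi.
Qed.

(** The difference of the two sides vanishes at 0 and has derivative
    sin^n cos + n (sinint n) sin >= 0. *)
Lemma sinint_le n x : 0 <= x <= pi / 2 ->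
  n%:R * cos x * sinint n x <= sin x ^+ n.+1.
Proof.
move=> /andP[x0 x1]; rewrite -subr_ge0.
have := @is_derive_ge0_le (fun x => sin x ^+ n.+1 - n%:R * cos x * sinint n x)
  (fun x => sin x ^+ n * cos x + n%:R * sinint n x * sin x) 0 x x0.
rewrite sinint0 sin0 mulr0 expr0n/= subrr; apply.
- move=> z /andP[z0 _]; have dI := is_derive_sinint n z z0; have dS := is_derive_sinX n.+1 z.
  by apply: is_derive_eq; rewrite /GRing.scale/=; ring.
- move=> z /andP[z0 zx]; move: (pi_gt0 R) => ?.
  have s0 : 0 <= sin z by rewrite sin_ge0_pi//; lra.
  have c0 : 0 <= cos z by rewrite cos_ge0_pihalf//; lra.
  have I0 : 0 <= sinint n z by rewrite ltW// sinint_gt0//; lra.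
  by rewrite addr_ge0// !mulr_ge0// exprn_ge0.
- move=> z; apply: cvgB.
    exact: (continuous_subspaceT (@continuous_sinX n.+1)).
  apply: cvgM; last exact: within_continuous_sinint.
  apply: cvgM; first exact: cvg_cst.
  exact: (continuous_subspaceT (@continuous_cos R)).
Qed.

(** A converse of the previous bound up to the factor 1 + d, valid as long as
    n cos^2 is large.  The derivative of the difference is bounded below by
    means of [sinint_le]. *)
Lemma sinint_ge n (d x : R) : (0 < n)%N -> 0 < d -> 0 <= x < pi / 2 -> 
  1 + d <= d * n%:R * cos x ^+ 2 ->
  sin x ^+ n.+1 <= (1 + d) * n%:R * cos x * sinint n x.
Proof.
move=> n0 d0 /andP[x0 x1] h; rewrite -subr_ge0.
have := @is_derive_ge0_le (fun x => (1 + d) * n%:R * cos x * sinint n x - sin x ^+ n.+1)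
  (fun x => (d * n%:R - 1) * (sin x ^+ n * cos x)
     - (1 + d) * n%:R * sinint n x * sin x) 0 x x0.
rewrite sinint0 sin0 mulr0 expr0n/= subrr; apply.
- move=> z /andP[z0 _]; have dI := is_derive_sinint n z z0; have dS := is_derive_sinX n.+1 z.
  by apply: is_derive_eq; rewrite /GRing.scale/=; ring.
- move=> z /andP[z0 zx]; move: (pi_gt0 R) => ?.
  have s0 : 0 <= sin z by rewrite sin_ge0_pi//; lra.
  have c0 : 0 < cos z by rewrite cos_gt0_pihalf//; lra.
  have cx0 : 0 < cos x by rewrite cos_gt0_pihalf//; lra.
  have cxz : cos x <= cos z.
    by rewrite ltW// ltr_cos ?in_itv/=//; lra.
  have I1 : n%:R * cos z * sinint n z <= sin z ^+ n.+1 by apply: sinint_le; lra.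
  have h' : 1 + d <= d * n%:R * cos z ^+ 2.
    apply: (le_trans h); rewrite ler_wpM2l ?mulr_ge0 ?(ltW d0)//.
    by rewrite lerXn2r// nnegrE ltW.
  rewrite -(pmulr_rge0 _ c0).
  have -> : cos z * ((d * n%:R - 1) * (sin z ^+ n * cos z)
     - (1 + d) * n%:R * sinint n z * sin z) =
     sin z ^+ n * ((d * n%:R - 1) * cos z ^+ 2)
     - (1 + d) * sin z * (n%:R * cos z * sinint n z) by ring.
  rewrite subr_ge0.
  apply: (@le_trans _ _ ((1 + d) * sin z * sin z ^+ n.+1)).
    by rewrite ler_wpM2l// mulr_ge0// addr_ge0// ltW.
  have -> : (1 + d) * sin z * sin z ^+ n.+1 = sin z ^+ n * ((1 + d) * sin z ^+ 2).
    by rewrite exprS; ring.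
  rewrite ler_wpM2l ?exprn_ge0// sin2cos2.
  have : 0 < cos z ^+ 2 by rewrite exprn_gt0.
  nra.
- move=> z; apply: cvgB; last first.
    exact: (continuous_subspaceT (@continuous_sinX n.+1)).
  apply: cvgM; last exact: within_continuous_sinint.
  apply: cvgM; first exact: cvg_cst.
  exact: (continuous_subspaceT (@continuous_cos R)).
Qed.

End calculus.

(** * Bounds on the drift *)

Section drift_bounds.
Context {R : realType}.
Implicit Types (d x y z : R) (n : nat).

Lemma pihalf_gt1 : 1 < pi / 2 :> R.
Proof.
rewrite lt_neqAle pihalf_ge1 andbT; apply/eqP => e.
by have := cos1_gt0 R; rewrite e cos_pihalf ltxx.
Qed.

(** Bernoulli's inequality. *)
Lemma onemX_ge (a : R) n : 0 <= a <= 1 -> 1 - n%:R * a <= (1 - a) ^+ n.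
Proof.
move=> /andP[a0 a1]; elim: n => [|n ih]; first by rewrite mul0r subr0 expr0.
rewrite exprSr -natr1; have n0 : 0 <= n%:R :> R by [].
have : 0 <= n%:R * a by rewrite mulr_ge0.
nra.
Qed.

Lemma sin_pihalfD y : sin (pi / 2 + y) = cos y :> R.
Proof. by rewrite addrC sinDpihalf. Qed.

Lemma cos_pihalfD y : cos (pi / 2 + y) = - sin y :> R.
Proof. by rewrite addrC cosDpihalf. Qed.

(** The drift in the coordinate centred at pi/2: a singular term, called the
    ratio below, and a tangent. *)
Lemma driftE n y : drift n (pi / 2 + y) =
  2 * (cos y ^+ n / sinint n (pi / 2 + y)) + n%:R * (sin y / cos y).
Proof. by rewrite /drift sin_pihalfD cos_pihalfD mulNr mulrN opprK. Qed.

Lemma le_tan z : 0 <= z < pi / 2 -> z <= sin z / cos z.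
Proof.
move=> /andP[z0 z1]; have c0 : 0 < cos z by rewrite cos_gt0_pihalf//; lra.
by rewrite ler_pdivlMr// sin_ge_Mcos//; lra.
Qed.

Lemma tan_le d z : 0 <= z -> z ^+ 2 <= d -> d <= 1 -> sin z / cos z <= (1 + d) * z.
Proof.
move=> z0 zd d1; have c1 := cos_ge z; have s1 := sin_le z z0.
have c0 : 0 < cos z by lra.
rewrite ler_pdivrMr//; apply: (le_trans s1).
have d0 : 0 <= d by rewrite (le_trans _ zd)// sqr_ge0.
rewrite -mulrA [_ * (_ * _)]mulrCA ler_peMr//.
have : (1 + d) * (1 - d / 2) <= (1 + d) * cos z by rewrite ler_wpM2l//; lra.
nra.
Qed.

Lemma sinint_pihalfD_gt0 n y : - (pi / 2) < y < pi / 2 -> 0 < sinint n (pi / 2 + y).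
Proof. by move=> ?; apply: sinint_gt0; lra. Qed.

(** Below pi/2 the ratio is at least the absolute value of the tangent term, so
    the drift pushes upwards there although the tangent is negative. *)
Lemma ratio_ge n z : 0 <= z < pi / 2 ->
  n%:R * (sin z / cos z) <= cos z ^+ n / sinint n (pi / 2 - z).
Proof.
move=> /andP[z0 z1]; have p0 := pi_gt0 R.
have c0 : 0 < cos z by rewrite cos_gt0_pihalf//; lra.
have I0 : 0 < sinint n (pi / 2 - z) by apply: sinint_pihalfD_gt0; lra.
rewrite ler_pdivlMr// mulrA mulrAC ler_pdivrMr// -exprSr.
have := @sinint_le R n (pi / 2 - z).
by rewrite sin_pihalfD cos_pihalfD sinN cosN opprK; apply; lra.
Qed.

Lemma ratio_gt0 n y : - (pi / 2) < y < pi / 2 ->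
  0 < cos y ^+ n / sinint n (pi / 2 + y).
Proof.
move=> yb; rewrite divr_gt0 ?exprn_gt0 ?cos_gt0_pihalf//.
exact: sinint_pihalfD_gt0.
Qed.

Lemma drift_ge_ratio n y : - (pi / 2) < y < pi / 2 ->
  cos y ^+ n / sinint n (pi / 2 + y) <= drift n (pi / 2 + y).
Proof.
move=> yb; rewrite driftE; have g0 := ratio_gt0 n y yb.
have c0 : 0 < cos y by rewrite cos_gt0_pihalf.
have [y0|y0] := leP 0 y.
  have : 0 <= n%:R * (sin y / cos y).
    by rewrite mulr_ge0// divr_ge0 ?(ltW c0)// sin_ge0_pi//; lra.
  lra.
have := @ratio_ge n (- y); rewrite cosN sinN opprK.
have -> : n%:R * (- sin y / cos y) = - (n%:R * (sin y / cos y)) by ring.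
by move=> /(_ ltac:(lra)); lra.
Qed.

Lemma drift_ge_dist n x : 0 < x < pi -> n%:R * `|x - pi / 2| <= drift n x.
Proof.
move=> xb; have yb : - (pi / 2) < x - pi / 2 < pi / 2 by lra.
have {2}-> : x = pi / 2 + (x - pi / 2) by rewrite addrC subrK.
move: (x - pi / 2) yb => y yb; rewrite driftE; have g0 := ratio_gt0 n y yb.
have [y0|y0] := leP 0 y.
  have : n%:R * y <= n%:R * (sin y / cos y).
    by rewrite ler_wpM2l// le_tan//; lra.
  by rewrite ger0_norm//; lra.
rewrite ltr0_norm//; have := @ratio_ge n (- y); rewrite cosN sinN opprK => /(_ ltac:(lra)).
have : n%:R * - y <= n%:R * (sin (- y) / cos (- y)).
  by rewrite ler_wpM2l// le_tan//; lra.
rewrite cosN sinN.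
have -> : n%:R * (- sin y / cos y) = - (n%:R * (sin y / cos y)) by ring.
lra.
Qed.

Lemma cosX_ge n y : (0 < n)%N -> `|y| <= (Num.sqrt n%:R)^-1 -> 2^-1 <= cos y ^+ n.
Proof.
move=> n0 yh; have n0' : 0 < n%:R :> R by rewrite ltr0n.
have y2 : y ^+ 2 <= n%:R^-1.
  rewrite -[leLHS]real_normK ?num_real// -[leRHS]sqr_sqrtr ?invr_ge0//.
  by rewrite lerXn2r ?nnegrE// sqrtrV.
have n1 : n%:R^-1 <= 1 :> R by rewrite invf_le1// ler1n.
apply: (@le_trans _ _ ((1 - (2 * n%:R)^-1) ^+ n)).
  have H : 0 <= (2 * n%:R : R)^-1 <= 1.
    by rewrite invr_ge0 mulr_ge0//= invfM; lra.
  apply: le_trans (onemX_ge _ n H).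
  by rewrite invfM mulrCA divff ?gt_eqF//; lra.
have : 1 - (2 * n%:R)^-1 <= cos y by have := cos_ge y; rewrite invfM; lra.
move=> ?; rewrite lerXn2r// nnegrE; rewrite ?invfM; last first.
  by rewrite (le_trans _ (cos_ge y))//; lra.
lra.
Qed.

Lemma sinint_le_mono n x y : 0 <= x -> x <= y -> y <= pi -> sinint n x <= sinint n y.
Proof.
move=> x0; rewrite le_eqVlt => /predU1P[-> //|xy] yp.
have [c cb e] := sinint_diff n x y x0 xy.
rewrite -subr_ge0 e mulr_ge0 ?subr_ge0 ?(ltW xy)// exprn_ge0// sin_ge0_pi//; lra.
Qed.

Lemma sinint_lip n x y : 0 <= x -> x <= y -> y <= pi ->
  sinint n y <= sinint n x + (y - x).
Proof.
move=> x0; rewrite le_eqVlt => /predU1P[->|xy] yp; first by rewrite subrr addr0.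
have [c cb e] := sinint_diff n x y x0 xy.
rewrite -lerBlDl e ler_piMl ?subr_ge0 ?(ltW xy)// exprn_ile1 ?sin_le1//.
Qed.

(** On the window of half-width h = 1 / sqrt n around pi/2 the numerator is at
    least 1/2, and the denominator at most 3 h: [sinint_le] gives h up to the
    left end of the window, and the window itself has length 2 h. *)
Lemma ratio_ge_sqrt n y : (0 < n)%N -> `|y| <= (Num.sqrt n%:R)^-1 ->
  Num.sqrt n%:R / 6 <= cos y ^+ n / sinint n (pi / 2 + y).
Proof.
move=> n0 yh; have cy := cosX_ge n y n0 yh.
have n0' : 0 < n%:R :> R by rewrite ltr0n.
set s := Num.sqrt n%:R in yh *.
have s0 : 0 < s by rewrite sqrtr_gt0.
have s2 : s ^+ 2 = n%:R by rewrite sqr_sqrtr// ltW.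
have s1 : 1 <= s by rewrite -sqrtr1 ler_wsqrtr// ler1n.
set h := s^-1 in yh *; have h0 : 0 < h by rewrite invr_gt0.
have h1 : h <= 1 by rewrite invf_le1.
have hs : h * s = 1 by rewrite mulVf// gt_eqF.
have p2 := pi_ge2 R.
have p4 := pihalf_gt1.
have /andP[y1 y2] : - h <= y <= h by rewrite -ler_norml.
have I0 : 0 < sinint n (pi / 2 + y) by apply: sinint_pihalfD_gt0; lra.
have Ih : sinint n (pi / 2 - h) <= h.
  have ch : 0 < cos h by rewrite cos_gt0_pihalf//; lra.
  have Ih0 : 0 < sinint n (pi / 2 - h) by apply: sinint_pihalfD_gt0; lra.
  have := @sinint_le R n (pi / 2 - h).
  rewrite sin_pihalfD cos_pihalfD sinN cosN opprK => /(_ ltac:(lra)) H1.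
  have H2 : cos h ^+ n.+1 <= cos h.
    by rewrite exprS ler_piMr ?(ltW ch)// exprn_ile1 ?cos_le1// ltW.
  have H3 : n%:R * (h * cos h) * sinint n (pi / 2 - h) <=
            n%:R * sin h * sinint n (pi / 2 - h).
    by rewrite ler_wpM2r ?(ltW Ih0)// ler_wpM2l ?(ltW n0')// sin_ge_Mcos//; lra.
  have H4 : s * sinint n (pi / 2 - h) * cos h <= 1 * cos h.
    rewrite mul1r; apply: le_trans H2; apply: le_trans H1; apply: le_trans H3.
    by rewrite -s2 le_eqVlt; apply/orP; left; apply/eqP;
       transitivity ((h * s) * s * sinint n (pi / 2 - h) * cos h);
       [rewrite hs; ring|ring].
  move: H4; rewrite ler_pM2r// => H4.
  by rewrite -(ler_pM2l s0) [s * h]mulrC hs.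
have I3 : sinint n (pi / 2 + y) <= 3 * h.
  have := @sinint_lip n (pi / 2 - h) (pi / 2 + y).
  by move=> /(_ ltac:(lra) ltac:(lra) ltac:(lra)); lra.
rewrite ler_pdivlMr//; apply: le_trans cy.
have : s / 6 * sinint n (pi / 2 + y) <= s / 6 * (3 * h).
  by rewrite ler_wpM2l// divr_ge0// ltW.
move=> /le_trans; apply.
have -> : s / 6 * (3 * h) = (h * s) / 2 by field.
by rewrite hs mul1r.
Qed.

Lemma drift_ge_sqrt n x : (0 < n)%N -> 0 < x < pi -> Num.sqrt n%:R / 6 <= drift n x.
Proof.
move=> n0 xb; have n0' : 0 < n%:R :> R by rewrite ltr0n.
have s0 : 0 < Num.sqrt n%:R :> R by rewrite sqrtr_gt0.
have [yh|yh] := leP `|x - pi / 2| (Num.sqrt n%:R)^-1.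
  have -> : x = pi / 2 + (x - pi / 2) by rewrite addrC subrK.
  apply: (le_trans (ratio_ge_sqrt n _ n0 yh)).
  by apply: drift_ge_ratio; lra.
apply: le_trans (drift_ge_dist n x xb).
have : n%:R * (Num.sqrt n%:R)^-1 <= n%:R * `|x - pi / 2| by rewrite ler_wpM2l ?ltW.
apply: le_trans.
rewrite -{2}[n%:R](@sqr_sqrtr R) ?ltW// expr2 mulfK ?gt_eqF//; lra.
Qed.

(** Above pi/2 the ratio is at most 2 sqrt n, which is negligible with respect
    to n |y|; below pi/2, [sinint_ge] makes it at most 1 + d times the
    tangent. *)
Lemma drift_le n d y : (0 < n)%N -> 0 < d <= 1 -> y ^+ 2 <= d ->
  4 / (d * Num.sqrt n%:R) <= `|y| ->
  drift n (pi / 2 + y) <= (1 + 5 * d) * (n%:R * `|y|).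
Proof.
move=> n0 /andP[d0 d1] yd yh.
have n0' : 0 < n%:R :> R by rewrite ltr0n.
set s := Num.sqrt n%:R in yh *.
have s0 : 0 < s by rewrite sqrtr_gt0.
have s2 : s ^+ 2 = n%:R by rewrite sqr_sqrtr// ltW.
have s1 : 1 <= s by rewrite -sqrtr1 ler_wsqrtr// ler1n.
have p4 := pihalf_gt1.
have y1 : `|y| <= 1.
  rewrite -(@expr_le1 _ 2)// real_normK ?num_real//; exact: le_trans d1.
have K : 4 <= d * s * `|y| by rewrite mulrC -ler_pdivrMr// mulr_gt0.
move: y1; rewrite ler_norml => /andP[y1 y2].
rewrite driftE; have [y0|y0] := leP 0 y.
  have T : n%:R * (sin y / cos y) <= n%:R * ((1 + d) * y).
    by rewrite ler_wpM2l ?(ltW n0')// tan_le.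
  set h := s^-1; have h0 : 0 < h by rewrite invr_gt0.
  have h1 : h <= 1 by rewrite invf_le1.
  have hs : h * s = 1 by rewrite mulVf// gt_eqF.
  (* sin^n is at least 1/2 on the window [pi/2 - h, pi/2]. *)
  have [c /andP[c1 c2] ce] := @sinint_diff R n (pi / 2 - h) (pi / 2) ltac:(lra) ltac:(lra).
  have sc : 2^-1 <= sin c ^+ n.
    have := @cosX_ge n (c - pi / 2) n0.
    rewrite -sin_pihalfD [pi / 2 + _]addrC subrK; apply.
    by rewrite -/s -/h ler_norml; lra.
  have I1 : h / 2 <= sinint n (pi / 2 + y).
    apply: (@le_trans _ _ (sinint n (pi / 2))); last by apply: sinint_le_mono; lra.
    have I0 : 0 < sinint n (pi / 2 - h) by apply: sinint_pihalfD_gt0; lra.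
    have : 2^-1 * h <= sin c ^+ n * (pi / 2 - (pi / 2 - h)).
      by rewrite opprB addrC subrK ler_wpM2r// ltW.
    lra.
  have g1 : cos y ^+ n / sinint n (pi / 2 + y) <= 2 * s.
    have I0 : 0 < sinint n (pi / 2 + y) by apply: lt_le_trans I1; lra.
    rewrite ler_pdivrMr//.
    apply: (@le_trans _ _ 1).
      by rewrite exprn_ile1 ?cos_le1// ltW// cos_gt0_pihalf//; lra.
    have : 2 * s * (h / 2) <= 2 * s * sinint n (pi / 2 + y).
      by rewrite ler_wpM2l// mulr_ge0// ltW.
    apply: le_trans; have -> : 2 * s * (h / 2) = h * s by field.
    by rewrite hs.
  rewrite ger0_norm// in K *.
  have : 4 * s <= d * (n%:R * y).
    have -> : d * (n%:R * y) = (d * s * y) * s by rewrite -s2; ring.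
    by rewrite ler_wpM2r// ltW.
  have : 0 <= d * (n%:R * y) by rewrite !mulr_ge0// ltW.
  lra.
rewrite ltr0_norm// in K *.
have := @sinint_ge R n d (pi / 2 + y) n0 d0 ltac:(lra).
rewrite sin_pihalfD cos_pihalfD sqrrN.
have T := @tan_le d (- y) ltac:(lra); rewrite sqrrN cosN sinN in T.
have {}T := T yd d1.
have c0 : 2^-1 <= cos y by have := cos_ge y; lra.
have S1 := @sin_ge_Mcos R (- y) ltac:(lra); rewrite cosN sinN in S1.
have S2 : - y / 2 <= - sin y by apply: le_trans S1; rewrite ler_wpM2l//; lra.
have S3 : (- y / 2) ^+ 2 <= sin y ^+ 2.
  by rewrite -[in leRHS]sqrrN lerXn2r ?nnegrE//; lra.
have C : 1 + d <= d * n%:R * sin y ^+ 2.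
  have : d * n%:R * (- y / 2) ^+ 2 <= d * n%:R * sin y ^+ 2.
    by rewrite ler_wpM2l// mulr_ge0// ltW.
  apply: le_trans; rewrite -(ler_pM2l d0).
  have -> : d * (d * n%:R * (- y / 2) ^+ 2) = (d * s * - y) ^+ 2 / 4.
    by rewrite -s2; field.
  have : 4 ^+ 2 <= (d * s * - y) ^+ 2 by rewrite lerXn2r ?nnegrE//; lra.
  nra.
move=> /(_ C) H.
have I0 : 0 < sinint n (pi / 2 + y) by apply: sinint_pihalfD_gt0; lra.
have G : cos y ^+ n / sinint n (pi / 2 + y) <= (1 + d) * (n%:R * (- sin y / cos y)).
  have -> : (1 + d) * (n%:R * (- sin y / cos y)) =
    ((1 + d) * n%:R * - sin y) / cos y by ring.
  by rewrite ler_pdivrMr// mulrAC ler_pdivlMr -?exprSr//; lra.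
have T' : n%:R * (- sin y / cos y) <= n%:R * ((1 + d) * - y).
  by rewrite ler_wpM2l// ltW.
have Y0 : 0 <= n%:R * - y by rewrite mulr_ge0 ?(ltW n0')//; lra.
have : (1 + 2 * d) * (n%:R * (- sin y / cos y)) <= (1 + 2 * d) * (n%:R * ((1 + d) * - y)).
  by rewrite ler_wpM2l//; lra.
have -> : n%:R * (sin y / cos y) = - (n%:R * (- sin y / cos y)) by ring.
move: (n%:R * (- sin y / cos y)) G => t G L.
have : (1 + 2 * d) * (n%:R * ((1 + d) * - y)) <= (1 + 5 * d) * (n%:R * - y).
  have -> : (1 + 2 * d) * (n%:R * ((1 + d) * - y)) =
    ((1 + 2 * d) * (1 + d)) * (n%:R * - y) by ring.
  by rewrite ler_wpM2r//; nra.
lra.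
Qed.

Lemma continuous_drift n x : 0 < x < pi -> {for x, continuous (drift n : R -> R)}.
Proof.
move=> xb; have s0 : sin x != 0 by rewrite gt_eqF// sin_gt0_pi.
have I0 : sinint n x != 0 by rewrite gt_eqF// sinint_gt0.
apply: cvgB.
  apply: cvgM; first exact: cvg_cst.
  apply: cvgM; first exact: continuous_sinX.
  apply: cvgV => //.
  have /andP[x0 _] := xb; have dI := is_derive_sinint n x x0.
  by apply: differentiable_continuous; apply/derivable1_diffP; exact: ex_derive.
apply: cvgM; first exact: cvg_cst.
apply: cvgM; first exact: continuous_cos.
by apply: cvgV => //; exact: continuous_sin.
Qed.

End drift_bounds.

(** * Paths of the perturbed differential equation *)

Section paths.
Context {R : realType}.
Implicit Types (n : nat).

Lemma path_continuousW (x : R -> R) (a b : R) : path_continuous x -> 0 <= a ->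
  {within `[a, b], continuous x}.
Proof.
move=> cx a0; apply: continuous_subspaceW cx => t /=.
by rewrite in_itv/= => /andP[+ _]; exact: le_trans.
Qed.

Lemma path_continuous_gt0 (x : R -> R) (t : R) : path_continuous x -> 0 < t ->
  {for t, continuous x}.
Proof.
move=> cx t0; apply: (@within_continuous_continuous _ _ _ 0 (t + 1)).
- by rewrite addr_gt0.
- exact: path_continuousW.
- by rewrite in_itv/= t0 ltrDl ltr01.
Qed.

(** The fundamental theorem of calculus for the equation x = v + int f, whose
    integrand may be singular at time 0. *)
Lemma is_derive_subr_integral (f x v : R -> R) (tau : \bar R) (t : R) :
  0 < t -> (t%:E < tau)%E -> {for t, continuous f} ->
  (forall s, 0 <= s -> (s%:E < tau)%E ->
     lebesgue_measure.-integrable `[0, s] (EFin \o f)) ->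
  (forall s, 0 <= s -> (s%:E < tau)%E ->
     x s = v s + (\int[lebesgue_measure]_(u in `[0, s]) f u)%R) ->
  is_derive t 1 (fun s => x s - v s) (f t).
Proof.
move=> t0 tt cf fi fe.
have [u tu ut] : exists2 u, t < u & (u%:E < tau)%E.
  move: tau tt {fi fe} => [m| |]//=.
    rewrite lte_fin => tm; exists ((t + m) / 2); rewrite ?lte_fin; lra.
  by move=> _; exists (t + 1); rewrite ?ltry// ltrDl.
have u0 : 0 <= u by rewrite ltW// (lt_trans t0).
have [d e] := @continuous_FTC1_closed R f 0 t u tu (fi _ u0 ut) t0 cf.
apply: near_eq_is_derive; last by apply: DeriveDef; [exact: d|rewrite -derive1E].
near=> s; rewrite /= fe; first by rewrite addrAC subrr add0r.
- by apply: ltW; near: s; exact: lt_nbhsr.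
- apply: lt_trans ut; rewrite lte_fin; near: s; exact: lt_nbhsl.
Unshelve. all: by end_near. Qed.

(** Gronwall's inequality, for a rate k of either sign. *)
Lemma gronwall_ge (k : R) (f df : R -> R) (a b : R) : a <= b ->
  {within `[a, b], continuous f} ->
  (forall t, a < t < b -> is_derive t 1 f (df t)) ->
  (forall t, a < t < b -> k * f t <= df t) ->
  f a * expR (k * (b - a)) <= f b.
Proof.
move=> ab cf dfE dfk.
have H : f a * expR (- (k * a)) <= f b * expR (- (k * b)).
  apply: (@is_derive_ge0_le _ (fun t => f t * expR (- (k * t)))
    (fun t => (df t - k * f t) * expR (- (k * t)))) => //.
  - move=> t /dfE dft; apply: is_derive_eq.
    by rewrite /GRing.scale/=; ring.
  - by move=> t /dfk kf; rewrite mulr_ge0 ?expR_ge0// subr_ge0.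
  - move=> t; apply: cvgM; first exact: cf.
    apply: continuous_subspaceT => z; apply: continuous_comp; last exact: continuous_expR.
    by apply: cvgN; apply: cvgM; [exact: cvg_cst|exact: cvg_id].
rewrite mulrBr expRD mulrA mulrAC -ler_pdivlMr ?expR_gt0//.
by rewrite -expRN.
Qed.

Variables (n : nat) (x v : R -> R) (tau : \bar R) (e : R).
Hypothesis n0 : (0 < n)%N.
Hypothesis cx : path_continuous x.
Hypothesis cv : path_continuous v.
Hypothesis x0 : x 0 = 0.
Hypothesis v0 : v 0 = 0.
Hypothesis dom : forall t, 0 < t -> (t%:E < tau)%E -> 0 < x t < pi.
Hypothesis sint : forall t, 0 <= t -> (t%:E < tau)%E ->
    lebesgue_measure.-integrable `[0, t] (fun s => (drift n (x s))%:E).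
Hypothesis sde : forall t, 0 <= t -> (t%:E < tau)%E ->
    x t = v t + (\int[lebesgue_measure]_(s in `[0, t]) drift n (x s))%R.

Lemma path_continuousB (a b : R) : 0 <= a ->
  {within `[a, b], continuous (fun t => x t - v t)}.
Proof.
by move=> a0; apply: within_continuousB; exact: path_continuousW.
Qed.

Lemma is_derive_path t : 0 < t -> (t%:E < tau)%E ->
  is_derive t 1 (fun s => x s - v s) (drift n (x t)).
Proof.
move=> t0 tt; apply: (is_derive_subr_integral (fun s => drift n (x s)) _ _ tau) => //.
apply: (@continuous_comp _ _ _ x (drift n)); first exact: path_continuous_gt0.
exact/continuous_drift/dom.
Qed.

(** The three durations are those of the approach to the window
    [pi/2 - 2 e, pi/2 + 2 e], of its crossing, and of the escape from it. *)
Lemma path_reaches_pi (tA tB tC : R) : 0 < e -> 0 <= tA -> 0 <= tB -> 0 <= tC ->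
  0 < tA + tB + tC ->
  (forall t, 0 <= t <= tA + tB + tC -> `|v t| <= e) ->
  pi / 2 <= e * expR (n%:R * tA) -> 24 * e <= Num.sqrt n%:R * tB ->
  pi / 2 <= e * expR (n%:R * tC) -> (tau <= (tA + tB + tC)%:E)%E.
Proof.
move=> e0 tA0 tB0 tC0 T0 ve hA hB hC; rewrite leNgt; apply/negP => Tt.
set T := tA + tB + tC in T0 ve Tt.
have lt_tau t : t <= T -> (t%:E < tau)%E.
  by move=> tT; apply: le_lt_trans Tt; rewrite lee_fin.
pose z t := x t - v t - pi / 2.
have cz a b : 0 <= a -> {within `[a, b], continuous z}.
  move=> a0; apply: within_continuousB; first exact: path_continuousB.
  by apply: continuous_subspaceT => ?; exact: cvg_cst.
have dz t : 0 < t -> t <= T -> is_derive t 1 z (drift n (x t)).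
  move=> t0 /lt_tau tT; have H := is_derive_path t t0 tT.
  by apply: is_derive_eq; rewrite subr0.
have lo t : 0 < t -> t <= T -> n%:R * (`|z t| - e) <= drift n (x t).
  move=> t0 tT; apply: le_trans (drift_ge_dist n _ (dom _ t0 (lt_tau _ tT))).
  rewrite ler_wpM2l// lerBlDr.
  have -> : z t = (x t - pi / 2) - v t by rewrite /z; ring.
  by rewrite (le_trans (ler_normB _ _))// lerD2l ve// (ltW t0).
have z0 : z 0 = - (pi / 2) by rewrite /z x0 v0; ring.
have pA : - 2 * e <= z tA.
  have := @gronwall_ge (- n%:R) (fun t => z t + e) (fun t => drift n (x t)) 0 tA tA0.
  rewrite subr0 z0 => H; have {H} : (- (pi / 2) + e) * expR (- n%:R * tA) <= z tA + e.
    apply: H.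
    - apply: within_continuousD; first exact: cz.
      by apply: continuous_subspaceT => ?; exact: cvg_cst.
    - move=> t /andP[t0 tt]; have tT : t <= T by rewrite /T; lra.
      have H := dz t t0 tT.
      by apply: is_derive_eq; rewrite addr0.
    - move=> t /andP[t0 tt]; have tT : t <= T by rewrite /T; lra.
      apply: le_trans (lo t t0 tT); rewrite mulNr -mulrN ler_wpM2l//.
      by rewrite opprD lerD2r -normrN ler_norm.
  have E0 : 0 < expR (- n%:R * tA) by exact: expR_gt0.
  have : pi / 2 * expR (- n%:R * tA) <= e.
    by rewrite mulNr expRN ler_pdivrMr ?expR_gt0.
  have : 0 <= e * expR (- n%:R * tA) by rewrite mulr_ge0 ?ltW.
  lra.
have pB : 2 * e <= z (tA + tB).
  have := @is_derive_ge0_le _ (fun t => z t - (Num.sqrt n%:R / 6) * t)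
    (fun t => drift n (x t) - Num.sqrt n%:R / 6) tA (tA + tB) ltac:(lra).
  move=> H; have {H} : z tA - Num.sqrt n%:R / 6 * tA <=
      z (tA + tB) - Num.sqrt n%:R / 6 * (tA + tB).
    apply: H.
    - move=> t /andP[t0 tt]; have tT : t <= T by rewrite /T; lra.
      have H := dz t (le_lt_trans tA0 t0) tT.
      by apply: is_derive_eq; rewrite /GRing.scale/=; ring.
    - move=> t /andP[t0 tt]; have tT : t <= T by rewrite /T; lra.
      have t0' := le_lt_trans tA0 t0.
      by rewrite subr_ge0; apply: drift_ge_sqrt => //; apply: dom => //; exact: lt_tau.
    - apply: within_continuousB; first exact: cz.
      apply: continuous_subspaceT => ?.
      by apply: cvgM; [exact: cvg_cst|exact: cvg_id].
  lra.
(* At time T the path would exceed pi, although T precedes tau. *)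
have pC : pi / 2 + e <= z T.
  have tAB : tA + tB <= T by rewrite /T; lra.
  have := @gronwall_ge n%:R (fun t => z t - e) (fun t => drift n (x t)) (tA + tB) T tAB.
  have -> : T - (tA + tB) = tC by rewrite /T; ring.
  move=> H; have {H} : (z (tA + tB) - e) * expR (n%:R * tC) <= z T - e.
    apply: H.
    - apply: within_continuousB; first by apply: cz; lra.
      by apply: continuous_subspaceT => ?; exact: cvg_cst.
    - move=> t /andP[t0 tt]; have tT : t <= T by rewrite ltW.
      have H := dz t (le_lt_trans (addr_ge0 tA0 tB0) t0) tT.
      by apply: is_derive_eq; rewrite subr0.
    - move=> t /andP[t0 tt]; have tT : t <= T by rewrite ltW.
      apply: le_trans (lo t (le_lt_trans (addr_ge0 tA0 tB0) t0) tT).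
      by rewrite ler_wpM2l// lerD2r ler_norm.
  have : e * expR (n%:R * tC) <= (z (tA + tB) - e) * expR (n%:R * tC).
    by rewrite ler_wpM2r ?expR_ge0//; lra.
  lra.
have /andP[_] := dom T T0 Tt.
have : `|v T| <= e by apply: ve; rewrite lexx ltW.
rewrite ler_norml => /andP[+ _]; rewrite /z in pC; lra.
Qed.

(** The two factors 3 e / d correspond to the two crossings of the region where
    the distance to pi/2 is between 2 e and d - e; their product bounds
    exp((1 + 5 d) n m) from below. *)
Lemma path_time_ge (d m : R) : 0 < e -> 0 < d <= 1 -> 3 * e < d ->
  4 / (d * Num.sqrt n%:R) <= e -> 0 <= m -> tau = m%:E -> x m = pi ->
  (forall t, 0 <= t <= m -> `|v t| <= e) ->
  d ^+ 2 <= 9 * e ^+ 2 * expR ((1 + 5 * d) * n%:R * m).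
Proof.
move=> e0 /andP[d0 d1] ed he m0 tm xm ve.
have lt_tau t : t < m -> (t%:E < tau)%E by rewrite tm lte_fin.
pose z t := x t - v t - pi / 2.
have cz a b : 0 <= a -> {within `[a, b], continuous z}.
  move=> a0; apply: within_continuousB; first exact: path_continuousB.
  by apply: continuous_subspaceT => ?; exact: cvg_cst.
have dz t : 0 < t -> t < m -> is_derive t 1 z (drift n (x t)).
  move=> t0 /lt_tau tT; have H := is_derive_path t t0 tT.
  by apply: is_derive_eq; rewrite subr0.
have mono s t : 0 <= s -> s <= t -> t <= m -> z s <= z t.
  move=> s0 st tm'.
  apply: (@is_derive_ge0_le _ z (fun u => drift n (x u))) => //.
  - by move=> u /andP[su ut]; apply: dz; lra.
  - move=> u /andP[su ut]; have ub : 0 < x u < pi by apply: dom; [lra|apply: lt_tau; lra].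
    by apply: le_trans (drift_ge_dist n _ ub); rewrite mulr_ge0.
  - exact: cz.
set l := 1 + 5 * d.
have l0 : 0 <= l by rewrite /l; lra.
have up t : 0 < t -> t < m -> 2 * e <= `|z t| <= d - e ->
    drift n (x t) <= l * n%:R * (`|z t| + e).
  move=> t0 tm' /andP[za zb].
  have vt : `|v t| <= e by apply: ve; lra.
  have xz : x t - pi / 2 = z t + v t by rewrite /z; ring.
  have -> : x t = pi / 2 + (x t - pi / 2) by rewrite addrC subrK.
  have n1 : `|x t - pi / 2| <= `|z t| + e.
    by rewrite xz (le_trans (ler_normD _ _))// lerD2l.
  have n2 : e <= `|x t - pi / 2|.
    have := lerB_normD (z t) (v t); rewrite -xz; lra.
  apply: (@le_trans _ _ (l * (n%:R * `|x t - pi / 2|))); last first.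
    by rewrite -mulrA ler_wpM2l// ler_wpM2l.
  apply: drift_le => //; first by rewrite d0.
  - rewrite -[_ ^+ 2]real_normK ?num_real//.
    apply: (@le_trans _ _ (d ^+ 2)); first by rewrite lerXn2r ?nnegrE//; lra.
    by rewrite expr2 ler_piMr// ltW.
  - exact: le_trans he n2.
have p2 := pi_ge2 R.
have z0 : z 0 = - (pi / 2) by rewrite /z x0 v0; ring.
have zm : d - e <= z m.
  have : `|v m| <= e by apply: ve; rewrite lexx m0.
  by rewrite ler_norml /z xm => /andP[_]; lra.
have ivt a c : 0 <= a <= m -> z a <= c <= z m ->
    exists2 t, a <= t <= m & z t = c.
  move=> /andP[a0 am] /andP[ac cm].
  have [|t + <-] := @IVT _ z a m c am (cz a m a0).
    by rewrite ge_min ac le_max cm orbT.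
  by rewrite in_itv/=; exists t.
(* Successive times at which z takes the four levels in increasing order. *)
have [t1 /andP[t10 t1m] zt1] := ivt 0 (- (d - e)) ltac:(lra) ltac:(lra).
have [t2 /andP[t20 t2m] zt2] := ivt t1 (- (2 * e)) ltac:(lra) ltac:(lra).
have [t3 /andP[t30 t3m] zt3] := ivt t2 (2 * e) ltac:(lra) ltac:(lra).
have [t4 /andP[t40 t4m] zt4] := ivt t3 (d - e) ltac:(lra) ltac:(lra).
have h1 : d * expR (- (l * n%:R) * (t2 - t1)) <= 3 * e.
  have := @gronwall_ge (- (l * n%:R)) (fun t => - z t + e) (fun t => - drift n (x t)) t1 t2 t20.
  rewrite zt1 zt2 !opprK.
  have -> : d - e + e = d by ring.
  have -> : 2 * e + e = 3 * e by ring.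
  apply.
  - apply: within_continuousD.
      by move=> s; apply: cvgN; exact: cz.
    by apply: continuous_subspaceT => ?; exact: cvg_cst.
  - move=> t /andP[ta tb]; have H := dz t (le_lt_trans t10 ta) (lt_le_trans tb t2m).
    by apply: is_derive_eq; rewrite addr0.
  - move=> t /andP[ta tb]; have t0 := le_lt_trans t10 ta.
    have tm' := lt_le_trans tb t2m.
    have zb1 : z t1 <= z t by apply: mono; lra.
    have zb2 : z t <= z t2 by apply: mono; lra.
    have := up t t0 tm'; rewrite ler0_norm; last lra.
    by move=> /(_ ltac:(lra)); rewrite mulNr lerN2.
have h2 : d <= 3 * e * expR (l * n%:R * (t4 - t3)).
  have := @gronwall_ge (l * n%:R) (fun t => - z t - e) (fun t => - drift n (x t)) t3 t4 t40.
  rewrite zt3 zt4.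
  have -> : - (d - e) - e = - d by ring.
  have -> : - (2 * e) - e = - (3 * e) by ring.
  rewrite mulNr lerN2; apply.
  - apply: within_continuousB.
      by move=> s; apply: cvgN; apply: cz; lra.
    by apply: continuous_subspaceT => ?; exact: cvg_cst.
  - move=> t /andP[ta tb]; have H := dz t ltac:(lra) (lt_le_trans tb t4m).
    by apply: is_derive_eq; rewrite subr0.
  - move=> t /andP[ta tb]; have t0 : 0 < t by lra.
    have tm' := lt_le_trans tb t4m.
    have zb1 : z t3 <= z t by apply: mono; lra.
    have zb2 : z t <= z t4 by apply: mono; lra.
    have := up t t0 tm'; rewrite ger0_norm; last lra.
    by move=> /(_ ltac:(lra)); rewrite -opprD mulrN lerN2.
have {}h1 : d <= 3 * e * expR (l * n%:R * (t2 - t1)).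
  by rewrite -ler_pdivrMr ?expR_gt0// -expRN -mulNr.
apply: (@le_trans _ _ (9 * e ^+ 2 * expR (l * n%:R * (t2 - t1) + l * n%:R * (t4 - t3)))).
  rewrite expRD.
  have -> : 9 * e ^+ 2 * (expR (l * n%:R * (t2 - t1)) * expR (l * n%:R * (t4 - t3))) =
   (3 * e * expR (l * n%:R * (t2 - t1))) * (3 * e * expR (l * n%:R * (t4 - t3))) by ring.
  by rewrite expr2 ler_pM// ltW.
rewrite ler_wpM2l ?mulr_ge0 ?exprn_ge0 ?(ltW e0)//.
rewrite ler_expR -mulrDr ler_wpM2l ?mulr_ge0//; lra.
Qed.

End paths.

(** * Dyadic grids and continuous paths *)

Section grid.
Context {R : realType}.
Implicit Types (T t : R) (N k : nat).

(** The point of index k in the grid of 2^N steps on [0, T]. *)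
Definition dyadic T N k : R := T * (k%:R / (2 ^ N)%:R).

Lemma dyadic_bounds T N k : 0 <= T -> (k <= 2 ^ N)%N -> 0 <= dyadic T N k <= T.
Proof.
move=> T0 kN; have p0 : 0 < (2 ^ N)%:R :> R by rewrite ltr0n expn_gt0.
rewrite /dyadic mulr_ge0//= ?divr_ge0 ?(ltW p0)//.
by rewrite ler_piMr// ler_pdivrMr// mul1r ler_nat.
Qed.

Lemma dyadic_dense T t (e : R) : 0 <= t <= T -> 0 < e ->
  exists N k, (k <= 2 ^ N)%N /\ `|t - dyadic T N k| < e.
Proof.
move=> /andP[t0 tT] e0; have [T0|T0] := ltP 0 T; last first.
  exists 0%N, 0%N; split => //.
  by rewrite /dyadic mul0r mulr0 subr0 ger0_norm//; lra.
pose N := (Num.truncn (T / e)).+1; pose p : R := (2 ^ N)%:R.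
have p0 : 0 < p by rewrite ltr0n expn_gt0.
have pN : T / e < p.
  apply: (@lt_trans _ _ N%:R); last by rewrite ltr_nat ltn_expl.
  by have /andP[] := truncn_itv (divr_ge0 (ltW T0) (ltW e0)).
have tp : 0 <= t / T * p by rewrite mulr_ge0 ?divr_ge0 ?(ltW T0) ?(ltW p0).
exists N, (Num.truncn (t / T * p)); have /andP[k1 k2] := truncn_itv tp.
split.
  rewrite -(@ler_nat R) (le_trans k1)// -/p ler_piMl ?(ltW p0)//.
  by rewrite ler_pdivrMr// mul1r.
have tE : t = T * ((t / T * p) / p) 
  by rewrite mulfK ?(lt0r_neq0 p0)// [T * _]mulrC divfK// lt0r_neq0.
rewrite {1}tE /dyadic -/p -mulrBr -mulrBl normrM normrM normfV.
rewrite (gtr0_norm T0) (gtr0_norm p0) mulrA ltr_pdivrMr//.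
move: pN; rewrite ltr_pdivrMr// => pN; rewrite mulrC [e * p]mulrC.
apply: le_lt_trans pN; rewrite ler_piMl ?(ltW T0)//.
by rewrite -natr1 in k2; rewrite ger0_norm ?subr_ge0// lerBlDl ltW.
Qed.

Lemma dyadicS T N k : dyadic T N.+1 (2 * k)%N = dyadic T N k.
Proof.
rewrite /dyadic expnS !natrM; field.
by rewrite pnatr_eq0 -lt0n expn_gt0.
Qed.

Lemma path_near (x : R -> R) t (e : R) : path_continuous x -> 0 <= t -> 0 < e ->
  exists2 d, 0 < d & forall s, 0 <= s -> `|t - s| < d -> `|x t - x s| < e.
Proof.
move=> cx t0 e0; have /subspace_continuousP/(_ t t0) := cx.
move=> /cvgrPdist_lt /(_ e e0); rewrite /within/= => -[d d0 H].
by exists d => // s s0 ts; exact: H.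
Qed.

Lemma dyadic_sup (x : R -> R) T b : path_continuous x ->
  (forall N k, (k <= 2 ^ N)%N -> `|x (dyadic T N k)| <= b) ->
  forall t, 0 <= t <= T -> `|x t| <= b.
Proof.
move=> cx xb t tT; have /andP[t0 t1] := tT.
apply/ler_addgt0Pr => e e0.
have [d d0 H] := path_near x t e cx t0 e0.
have [N [k [kN tk]]] := dyadic_dense T t d tT d0.
have s0 : 0 <= dyadic T N k.
  by have /andP[] := dyadic_bounds T N k (le_trans t0 t1) kN.
rewrite -(subrK (x (dyadic T N k)) (x t)) addrC.
by rewrite (le_trans (ler_normD _ _))// lerD ?xb// ltW// H.
Qed.

(** For a continuous path, reaching a level on [0, T] only depends on the values
    on the dyadic grids. *)
Lemma dyadic_level (x : R -> R) T a : path_continuous x -> 0 <= T ->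
  (exists t, 0 <= t <= T /\ x t = a) <->
  (forall m, exists N k, (k <= 2 ^ N)%N /\ `|x (dyadic T N k) - a| < m.+1%:R^-1).
Proof.
move=> cx T0; split.
  move=> [t [tT xt]] m; have /andP[t0 _] := tT.
  have m0 : 0 < m.+1%:R^-1 :> R by rewrite invr_gt0.
  have [d d0 H] := path_near x t _ cx t0 m0.
  have [N [k [kN tk]]] := dyadic_dense T t d tT d0.
  exists N, k; split => //; rewrite distrC -xt; apply: H => //.
  by have /andP[] := dyadic_bounds T N k T0 kN.
move=> H; have [|c] := @EVT_min R (fun t => `|x t - a|) 0 T T0.
  move=> t; apply: cvg_norm; apply: cvgB; last exact: cvg_cst.
  exact: (path_continuousW x 0 T cx (lexx 0)).
rewrite in_itv/= => cT cmin; exists c; split => //.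
apply/eqP; rewrite -subr_eq0 -normr_le0 leNgt; apply/negP => p0.
have [m mp] : exists m, m.+1%:R^-1 < `|x c - a|.
  exists (Num.truncn `|x c - a|^-1); rewrite invf_plt ?posrE//.
  by have /andP[] := truncn_itv (ltW (etrans (invr_gt0 `|x c - a|) p0)) .
have [N [k [kN xk]]] := H m.
have := cmin (dyadic T N k); rewrite in_itv/= dyadic_bounds// => /(_ isT).
by move=> /le_lt_trans /(_ xk) /(lt_trans mp); rewrite ltxx.
Qed.

End grid.

(** * Tail of the normal distribution *)

Section gaussian_tail.
Context {R : realType}.

Lemma measurable_norm_gt (a : R) : measurable ([set x | a < `|x|] : set (measurableTypeR R)).
Proof.
have -> : [set x | a < `|x|] = (fun x : R => `|x|) @^-1` `]a, +oo[%classic.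
  by apply/seteqP; split => x /=; rewrite in_itv/= andbT.
by rewrite -[X in measurable X]setTI; exact: normr_measurable.
Qed.

(** A bound on the probability that a centred normal variable of variance T
    exceeds a in absolute value. *)
Definition gauss_bound (a T : R) : R := Num.sqrt 2 * expR (- (a ^+ 2 / (4 * T))).

Lemma gauss_bound_ge0 (a T : R) : 0 <= gauss_bound a T.
Proof. by rewrite mulr_ge0 ?sqrtr_ge0 ?expR_ge0. Qed.

Lemma gauss_bound_le (a S T : R) : 0 < S -> S <= T -> gauss_bound a S <= gauss_bound a T.
Proof.
move=> S0 ST; have T0 := lt_le_trans S0 ST.
rewrite ler_wpM2l ?sqrtr_ge0// ler_expR lerN2 ler_wpM2l ?sqr_ge0//.
by rewrite lef_pV2 ?posrE ?mulr_gt0// ler_wpM2l.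
Qed.

(** Half of the exponent is bounded by its value at a; the other half is that of
    the density with twice the variance, whose total mass is 1. *)
Lemma normal_pdf_le (a s x : R) : 0 < s -> 0 <= a -> a < `|x| ->
  normal_pdf 0 s x <= gauss_bound a (s ^+ 2) * normal_pdf 0 (Num.sqrt 2 * s) x.
Proof.
move=> s0 a0 ax; have q0 : 0 < Num.sqrt 2 :> R by rewrite sqrtr_gt0.
have q2 : Num.sqrt 2 ^+ 2 = 2 :> R by rewrite sqr_sqrtr.
have ax2 : a ^+ 2 <= x ^+ 2.
  by rewrite -[leRHS]real_normK ?num_real// lerXn2r ?nnegrE// ltW.
rewrite !normal_pdfE ?gt_eqF ?mulr_gt0// /normal_fun /normal_peak /gauss_bound.
rewrite exprMn q2 subr0.
have -> : 2 * s ^+ 2 * pi *+ 2 = 2 * (s ^+ 2 * pi *+ 2) by rewrite mulrnAr !mulrA.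
rewrite (sqrtrM _ (ler0n _ 2)) [(Num.sqrt 2 * _)^-1]invfM.
set P := (Num.sqrt (s ^+ 2 * pi *+ 2))^-1.
have P0 : 0 <= P by rewrite invr_ge0 sqrtr_ge0.
set A := expR (- (a ^+ 2 / _)); set B := expR (_ / (2 * _ *+ 2)).
have -> : Num.sqrt 2 * A * ((Num.sqrt 2)^-1 * P * B) = P * (A * B).
  by field; rewrite gt_eqF.
rewrite ler_wpM2l// /A /B -expRD ler_expR.
have s20 : 0 < s ^+ 2 by rewrite exprn_gt0.
have -> : - x ^+ 2 / (s ^+ 2 *+ 2) = - (x ^+ 2 / (4 * s ^+ 2)) - x ^+ 2 / (4 * s ^+ 2).
  by field; rewrite gt_eqF.
have -> : - x ^+ 2 / (2 * s ^+ 2 *+ 2) = - (x ^+ 2 / (4 * s ^+ 2)).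
  by field; rewrite gt_eqF.
by rewrite lerD2r lerN2 ler_wpM2r// invr_ge0 mulr_ge0// ltW.
Qed.

Lemma normal_tail (a s : R) : 0 < s -> 0 <= a ->
  (normal_prob 0 s [set x | (a < `|x|)%R] <= (gauss_bound a (s ^+ 2))%:E)%E.
Proof.
move=> s0 a0; rewrite /normal_prob.
have mA := measurable_norm_gt a.
have q0 : 0 < Num.sqrt 2 :> R by rewrite sqrtr_gt0.
have mf t (D : set R) : measurable_fun D (EFin \o normal_pdf 0 t).
  apply/measurable_EFinP; apply: measurable_funTS; exact: measurable_normal_pdf.
apply: (@le_trans _ _ (\int[lebesgue_measure]_(x in [set x | (a < `|x|)%R])
   ((gauss_bound a (s ^+ 2))%:E * (normal_pdf 0 (Num.sqrt 2 * s) x)%:E))%E).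
  apply: ge0_le_integral => //.
  - by move=> x _; rewrite lee_fin normal_pdf_ge0.
  - exact: mf.
  - by apply: measurable_funeM; exact: mf.
  - by move=> x /= ax; rewrite -EFinM lee_fin normal_pdf_le.
rewrite ge0_integralZl_EFin ?gauss_bound_ge0//; last first.
- exact: mf.
- by move=> x _; rewrite lee_fin normal_pdf_ge0.
rewrite -[leRHS]mule1 lee_wpmul2l ?lee_fin ?gauss_bound_ge0//.
rewrite -(integral_normal_pdf 0 (Num.sqrt 2 * s)).
apply: ge0_subset_integral => //; first exact: mf.
by move=> x _; rewrite lee_fin normal_pdf_ge0.
Qed.

End gaussian_tail.

(** * A maximal inequality for Brownian motion *)

Section sigma_algebra_ops.
#[local] Set Implicit Arguments.
#[local] Unset Strict Implicit.
Context {T : Type} (G : set (set T)).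
Hypothesis sG : sigma_algebra setT G.

Lemma sigma_algebra_setC A : G A -> G (~` A).
Proof. by case: sG => _ h _ /h; rewrite setTD. Qed.

Lemma sigma_algebra_setU A B : G A -> G B -> G (A `|` B).
Proof.
case: sG => G0 _ h GA GB; rewrite -bigcup2E; apply: h.
by move=> [|[|k]].
Qed.

Lemma sigma_algebra_setD A B : G A -> G B -> G (A `\` B).
Proof.
move=> GA GB; rewrite -(setCK (A `\` B)) setCD.
by apply: sigma_algebra_setC; apply: sigma_algebra_setU => //; exact: sigma_algebra_setC.
Qed.

End sigma_algebra_ops.

Section maximal_inequality.
#[local] Set Implicit Arguments.
#[local] Unset Strict Implicit.
Context {R : realType} (d : measure_display) (T : measurableType d)
  (P : probability T R) (F : R -> set (set T)) (B : R -> T -> R).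
Hypothesis hF : filtration F.
Hypothesis hB : brownian_motion P F B.

Lemma adapted_measurable_fun (X : R -> T -> R) (t : R) : adapted F X -> 0 <= t ->
  measurable_fun setT (X t : T -> measurableTypeR R).
Proof.
move=> aX t0 _ A mA; rewrite setTI.
by apply: (filtration_measurable hF t0); exact: aX.
Qed.

Lemma adapted_norm_gt (t b : R) : 0 <= t -> F t [set w | b < `|B t w|].
Proof. by move=> t0; apply: (bm_adapted hB t0 (measurable_norm_gt b)). Qed.

Lemma measurable_incr (s t : R) : 0 <= s -> 0 <= t ->
  measurable_fun setT (fun w => B t w - B s w : measurableTypeR R).
Proof.
move=> s0 t0; apply: measurable_funB.
  exact: adapted_measurable_fun (bm_adapted hB) t0.
exact: adapted_measurable_fun (bm_adapted hB) s0.
Qed.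

Lemma measurable_incr_gt (s t b : R) : 0 <= s -> 0 <= t ->
  measurable [set w | b < `|B t w - B s w|].
Proof.
move=> s0 t0; have := measurable_incr s0 t0 measurableT (measurable_norm_gt b).
by rewrite setTI.
Qed.

Lemma measurable_norm_gt_at (t b : R) : 0 <= t -> measurable [set w | b < `|B t w|].
Proof. by move=> t0; apply: (filtration_measurable hF t0); exact: adapted_norm_gt. Qed.

Lemma incr_tail (s t a H : R) : 0 <= s -> s < t -> t - s <= H -> 0 <= a ->
  (P [set w | (a < `|B t w - B s w|)%R] <= (gauss_bound a H)%:E)%E.
Proof.
move=> s0 st tH a0; have ts0 : 0 < t - s by rewrite subr_gt0.
have := bm_gaussian hB s0 st (measurable_norm_gt a).
rewrite [X in P X](_ : _ = [set w | a < `|B t w - B s w|])// => ->.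
apply: le_trans (normal_tail a _ _ a0) _; first by rewrite sqrtr_gt0.
by rewrite lee_fin sqr_sqrtr ?(ltW ts0)// gauss_bound_le.
Qed.

(** The event that |B| exceeds b at one of the times t 0, ..., t m. *)
Fixpoint exceed (t : nat -> R) (b : R) (m : nat) : set T :=
  if m is k.+1 then exceed t b k `|` [set w | b < `|B (t k.+1) w|]
  else [set w | b < `|B (t 0%N) w|].

Lemma exceedP t b m w : exceed t b m w <-> exists2 j, (j <= m)%N & b < `|B (t j) w|.
Proof.
elim: m => [|m ih] /=.
  by split => [h|[j]]; [exists 0%N|rewrite leqn0 => /eqP ->].
split => [[/ih[j jm h]|h]|[j]].
- by exists j => //; exact: leqW.
- by exists m.+1.
- rewrite leq_eqVlt => /predU1P[->|jm] h; first by right.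
  by left; apply/ih; exists j.
Qed.

Lemma exceed_adapted (t : nat -> R) b m : (forall j, 0 <= t j) ->
  (forall i j, (i <= j)%N -> t i <= t j) -> F (t m) (exceed t b m).
Proof.
move=> t0 tm; elim: m => [|m ih] /=; first exact: adapted_norm_gt.
apply: sigma_algebra_setU; first exact: (filtration_sigma_algebra hF).
  by apply: (filtration_mono hF (t0 m) (tm _ _ (leqnSn m))).
exact: adapted_norm_gt.
Qed.

(** If |B s| > 2 a on the event A of the past of s, then |B t| <= a forces an
    increment larger than a, which is independent of A and has probability at
    most 1/2. *)
Lemma exit_half (s t a H : R) (A : set T) : 0 <= s -> s <= t -> t <= H -> 0 <= a ->
  gauss_bound a H <= 2^-1 -> F s A -> A `<=` [set w | 2 * a < `|B s w|] ->
  (P (A `&` ~` [set w | (a < `|B t w|)%R]) <= (2^-1)%:E * P A)%E.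
Proof.
move=> s0; rewrite le_eqVlt => /predU1P[<-|st] tH a0 q FA Aa.
  rewrite [X in P X](_ : _ = set0); last first.
    apply/seteqP; split => // w [/Aa/= h1 /negP]; rewrite -leNgt => h2.
    by move: (lt_le_trans h1 h2); rewrite ltNge; lra.
  by rewrite measure0 mule_ge0// lee_fin invr_ge0.
have t0 : 0 <= t by lra.
have mA : measurable A by exact: (filtration_measurable hF s0).
have mI := measurable_incr_gt a s0 t0.
apply: (@le_trans _ _ (P (A `&` [set w | (a < `|B t w - B s w|)%R]))).
  apply: le_measure; rewrite ?inE.
  - by apply: measurableI => //; apply: measurableC; exact: measurable_norm_gt_at.
  - exact: measurableI.
  - move=> w [Aw /negP]; rewrite -leNgt => h2; split => //=.
    have h1 := Aa _ Aw; rewrite /= in h1.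
    have := lerB_dist (B s w) (B t w); rewrite distrC; lra.
have := bm_independent hB s0 st FA (measurable_norm_gt a).
rewrite [X in P (_ `&` X)](_ : _ = [set w | a < `|B t w - B s w|])// => ->.
rewrite muleC lee_wpmul2r// (le_trans (incr_tail s0 st _ a0 (H := H)))//.
by lra.
Qed.

(** The previous lemma summed over the first time at which 2 a is exceeded. *)
Lemma exceed_half (t : nat -> R) (N m : nat) (a : R) : (forall j, 0 <= t j) ->
  (forall i j, (i <= j)%N -> t i <= t j) -> 0 <= a ->
  gauss_bound a (t N) <= 2^-1 -> (m <= N)%N ->
  (P (exceed t (2 * a) m `&` ~` [set w | (a < `|B (t N) w|)%R])
    <= (2^-1)%:E * P (exceed t (2 * a) m))%E.
Proof.
move=> t0 tm a0 q; elim: m => [|m ih] mN.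
  by apply: (@exit_half (t 0%N) (t N) a (t N)) => //; exact: tm || exact: adapted_norm_gt.
set C := ~` _ in ih *.
have mC : measurable C by apply: measurableC; exact: measurable_norm_gt_at.
pose E := exceed t (2 * a) m.
(* The first time at which 2 a is exceeded is t m.+1. *)
pose A := [set w | 2 * a < `|B (t m.+1) w|] `\` E.
have FE : F (t m.+1) E.
  by apply: (filtration_mono hF (t0 m) (tm _ _ (leqnSn m))); exact: exceed_adapted.
have FA : F (t m.+1) A.
  apply: sigma_algebra_setD => //; first exact: (filtration_sigma_algebra hF).
  exact: adapted_norm_gt.
have mE : measurable E by exact: (filtration_measurable hF (t0 m.+1)).
have mA : measurable A by exact: (filtration_measurable hF (t0 m.+1)).
have EA : exceed t (2 * a) m.+1 = E `|` A by rewrite /A setUDr setDv setD0.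
have dEA : E `&` A = set0 by rewrite /A setDE setIC -setIA setICl setI0.
rewrite EA setIUl measureU//; last 3 first.
- exact: measurableI.
- exact: measurableI.
- by rewrite setIACA dEA set0I.
rewrite measureU// ge0_muleDr//; apply: leeD; first exact/ih/ltnW.
apply: (@exit_half (t m.+1) (t N) a (t N)) => //; first exact: tm.
by move=> w [].
Qed.

(** Ottaviani's inequality. *)
Lemma exceed_le (t : nat -> R) (N : nat) (a : R) : (forall j, 0 <= t j) ->
  (forall i j, (i <= j)%N -> t i <= t j) -> 0 <= a -> 0 < t N ->
  gauss_bound a (t N) <= 2^-1 ->
  (P (exceed t (2 * a) N) <= (2 * gauss_bound a (t N))%:E)%E.
Proof.
move=> t0 tm a0 tN q; set E := exceed _ _ _; set D := [set w | a < `|B (t N) w|].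
have mE : measurable E by apply: (filtration_measurable hF (t0 N)); exact: exceed_adapted.
have mD : measurable D by exact: measurable_norm_gt_at.
have h1 := exceed_half t0 tm a0 q (leqnn N).
have h2 : (P D <= (gauss_bound a (t N))%:E)%E.
  have [Z [mZ Z0 BZ]] := bm_start hB.
  pose D' := [set w | a < `|B (t N) w - B 0 w|].
  have mD' : measurable D' by exact: measurable_incr_gt.
  apply: (@le_trans _ _ (P (D' `|` Z))).
    apply: le_measure; rewrite ?inE//; first exact: measurableU.
    move=> w Dw; have [Zw|Zw] := pselect (Z w); [by right|left].
    have B0 : B 0 w = 0 by apply: contrapT => h; apply: Zw; exact: BZ.
    by rewrite /D'/= B0 subr0.
  rewrite measureU0//; apply: incr_tail => //.
  by rewrite subr0.
have := measureDI P mE mD; rewrite -/E in h1 *.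
rewrite setDE => e.
have fE : P E \is a fin_num by rewrite fin_num_measure.
have h3 : (P E <= (2^-1)%:E * P E + (gauss_bound a (t N))%:E)%E.
  rewrite {1}e; apply: leeD => //.
  apply: le_trans h2; apply: le_measure; rewrite ?inE//; first exact: measurableI.
move: h3; rewrite -(fineK fE) -EFinM -EFinD !lee_fin; lra.
Qed.

(** The exceptional event is the increasing union of its traces on the dyadic
    grids, hence is measurable. *)
Lemma dyadic_sup_bound (H a : R) : 0 < H -> 0 <= a -> gauss_bound a H <= 2^-1 ->
  exists G : set T, [/\ measurable G, (P G <= (2 * gauss_bound a H)%:E)%E &
   {ae P, forall w, ~ G w -> forall t, 0 <= t <= H -> `|B t w| <= 2 * a}].
Proof.
move=> H0 a0 q.
(* The index is truncated so that the grid is defined for all k in nat. *)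
pose t N k := dyadic H N (minn k (2 ^ N)%N).
have t0 N k : 0 <= t N k.
  by have /andP[] := dyadic_bounds H N (minn k (2 ^ N)%N) (ltW H0) (geq_minr _ _).
have tm N i j : (i <= j)%N -> t N i <= t N j.
  move=> ij; rewrite /t /dyadic ler_wpM2l ?(ltW H0)// ler_wpM2r// ler_nat.
  by rewrite leq_min geq_minr andbT (leq_trans (geq_minl _ _)).
have tN N : t N (2 ^ N)%N = H.
  have p0 : (2 ^ N)%:R != 0 :> R by rewrite pnatr_eq0 -lt0n expn_gt0.
  by rewrite /t minnn /dyadic divff// mulr1.
pose G N := exceed (t N) (2 * a) (2 ^ N)%N.
have mG N : measurable (G N).
  by apply: (filtration_measurable hF (t0 N (2 ^ N)%N)); apply: exceed_adapted; [exact: t0|exact: tm].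
have GP N w : G N w <-> exists2 k, (k <= 2 ^ N)%N & 2 * a < `|B (dyadic H N k) w|.
  rewrite /G; split => [/exceedP[k kN h]|[k kN h]].
    by exists k => //; move: h; rewrite /t (minn_idPl kN).
  by apply/exceedP; exists k => //; rewrite /t (minn_idPl kN).
have GS N : G N `<=` G N.+1.
  move=> w /GP[k kN h]; apply/GP; exists (2 * k)%N; last by rewrite dyadicS.
  by rewrite expnS leq_mul2l.
have mU : measurable (\bigcup_N G N) by exact: bigcup_measurable.
exists (\bigcup_N G N); split => //.
  have cG : P \o G @ \oo --> P (\bigcup_N G N).
    apply: nondecreasing_cvg_mu => //.
    by apply/nondecreasing_seqP => N; apply/subsetPset; exact: GS.
  rewrite -(cvg_lim _ cG)//; apply: lime_le; first by apply/cvg_ex; eexists; exact: cG.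
  apply: nearW => N /=.
  by have := @exceed_le (t N) (2 ^ N)%N a (t0 N) (tm N) a0; rewrite !tN; apply.
apply: filterS (bm_continuous hB) => w cw nG.
apply: dyadic_sup => // N k kN; rewrite leNgt; apply/negP => h.
by apply: nG; exists N => //; apply/GP; exists k.
Qed.

End maximal_inequality.

(** * Hitting times *)

Section hitting_times.
Context {R : realType} {d : measure_display} {T : measurableType d}.
Implicit Types (X : R -> T -> R) (a c : R) (w : T).

Lemma hitting_time_ge0 a X w : (0 <= hitting_time a X w)%E.
Proof. by apply/ereal_infP => _ [t [t0 _] <-]; rewrite lee_fin. Qed.

(** The infimum is attained when it is finite. *)
Lemma hitting_time_le a X w c : path_continuous (X ^~ w) ->
  (hitting_time a X w <= c%:E)%E <-> exists t, 0 <= t <= c /\ X t w = a.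
Proof.
move=> cX; split; last first.
  move=> [t [/andP[t0 tc] Xt]]; apply: (@le_trans _ _ t%:E); last by rewrite lee_fin.
  by apply: ereal_inf_lbound; exists t.
move=> tc; have := hitting_time_ge0 a X w; case E: (hitting_time a X w) tc => [m| |]//.
rewrite !lee_fin => mc m0; exists m; rewrite m0 mc; split => //.
apply: contrapT => Xm; have e0 : 0 < `|X m w - a| by rewrite normr_gt0 subr_eq0; apply/eqP.
have [e e1 H] := path_near (X ^~ w) m _ cX m0 e0.
have : ((m + e)%:E <= hitting_time a X w)%E.
  apply/ereal_infP => _ [t [t0 Xt] <-]; rewrite lee_fin leNgt; apply/negP => tm.
  have mt : m <= t.
    by rewrite -lee_fin -E; apply: ereal_inf_lbound; exists t.
  have := H t t0; rewrite Xt ltxx distrC ger0_norm ?subr_ge0//.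
  by move=> /(_ ltac:(lra)).
by rewrite E lee_fin; lra.
Qed.

Lemma measurable_hitting_time_le a X c :
  (forall t, 0 <= t -> measurable_fun setT (X t : T -> measurableTypeR R)) ->
  (forall w, path_continuous (X ^~ w)) ->
  measurable [set w | (hitting_time a X w <= c%:E)%E].
Proof.
move=> mX cX; have [c0|c0] := leP 0 c; last first.
  rewrite (_ : [set _ | _] = set0)//; apply/seteqP; split => // w /=.
  by move=> /(le_trans (hitting_time_ge0 a X w)); rewrite lee_fin leNgt c0.
rewrite (_ : [set _ | _] = \bigcap_m \bigcup_N \bigcup_(k in [set k | (k <= 2 ^ N)%N])
  [set w | `|X (dyadic c N k) w - a| < m.+1%:R^-1]).
  apply: bigcap_measurable => // m _; apply: bigcup_measurable => N _.
  apply: bigcup_measurable => k kN.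
  have d0 : 0 <= dyadic c N k by have /andP[] := dyadic_bounds c N k c0 kN.
  have mf : measurable_fun setT (fun w => X (dyadic c N k) w - a : measurableTypeR R).
    by apply: measurable_funB => //; exact: mX.
  have mn : measurable ([set x | `|x| < m.+1%:R^-1] : set (measurableTypeR R)).
    rewrite (_ : [set _ | _] = `]- m.+1%:R^-1, m.+1%:R^-1[%classic)//.
    by apply/seteqP; split => x /=; rewrite in_itv/= ltr_norml.
  by have := mf measurableT _ mn; rewrite setTI.
apply/seteqP; split => w /=.
  move=> /(hitting_time_le _ _ _ _ (cX w))/(dyadic_level _ _ _ (cX w) c0) H m _.
  by have [N [k [kN h]]] := H m; exists N => //; exists k.
move=> H; apply/(hitting_time_le _ _ _ _ (cX w))/(dyadic_level _ _ _ (cX w) c0) => m.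
by have [N _ [k kN h]] := H m I; exists N, k.
Qed.

Lemma measurable_hitting_time_gt a X c :
  (forall t, 0 <= t -> measurable_fun setT (X t : T -> measurableTypeR R)) ->
  (forall w, path_continuous (X ^~ w)) ->
  measurable [set w | (c%:E < hitting_time a X w)%E].
Proof.
move=> mX cX; rewrite (_ : [set _ | _] = ~` [set w | (hitting_time a X w <= c%:E)%E]).
  by apply: measurableC; exact: measurable_hitting_time_le.
by apply/seteqP; split => w /=; rewrite ltNge => /negP.
Qed.

Lemma measurable_hitting_time_lt a X c :
  (forall t, 0 <= t -> measurable_fun setT (X t : T -> measurableTypeR R)) ->
  (forall w, path_continuous (X ^~ w)) ->
  measurable [set w | (hitting_time a X w < c%:E)%E].
Proof.
move=> mX cX; rewrite (_ : [set _ | _] =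
   \bigcup_m [set w | (hitting_time a X w <= (c - m.+1%:R^-1)%:E)%E]).
  by apply: bigcup_measurable => m _; exact: measurable_hitting_time_le.
apply/seteqP; split => w /=.
  have := hitting_time_ge0 a X w; case E: (hitting_time a X w) => [m| |]// _.
  rewrite lte_fin => mc; exists (Num.truncn (c - m)^-1) => //=.
  rewrite E lee_fin lerBrDr -lerBrDl ltW//.
  have cm : 0 < c - m by rewrite subr_gt0.
  rewrite invf_plt ?posrE//.
  by have /andP[] := truncn_itv (ltW (etrans (invr_gt0 (c - m)) cm)).
by move=> [m _ /= h]; apply: le_lt_trans h _; rewrite lte_fin gtrBl invr_gt0.
Qed.

End hitting_times.

Section comparison.
Context {R : realType} {d : measure_display} {T : measurableType d}
  (P : probability T R) (F : R -> set (set T)) (B X : R -> T -> R) (n : nat).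
Hypothesis hX : dual_radius n P F B X.

Lemma dual_radius_measurable (t : R) : 0 <= t ->
  measurable_fun setT (X t : T -> measurableTypeR R).
Proof.
move=> t0; apply: (adapted_measurable_fun (F := F)) => //.
  exact: dr_filtration hX.
exact: dr_adapted hX.
Qed.

(** To bound the probability of S, it is enough to show that S is disjoint from
    the paths that satisfy the equation and whose noise is at most e up to
    time H. *)
Lemma dual_radius_bound (H e : R) (S : set T) : 0 < H -> 0 <= e ->
  gauss_bound (e / 4) H <= 2^-1 -> measurable S ->
  (forall w, path_continuous (X ^~ w) ->
     path_continuous (fun t => Num.sqrt 2 * B t w) ->
     X 0 w = 0 -> Num.sqrt 2 * B 0 w = 0 ->
     (forall t, 0 < t -> (t%:E < tau X w)%E -> 0 < X t w < pi) ->
     (forall t, 0 <= t -> (t%:E < tau X w)%E ->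
       lebesgue_measure.-integrable `[0, t] (fun s => (drift n (X s w))%:E)) ->
     (forall t, 0 <= t -> (t%:E < tau X w)%E ->
       X t w = Num.sqrt 2 * B t w
            + (\int[lebesgue_measure]_(s in `[0, t]) drift n (X s w))%R) ->
     (forall t, 0 <= t <= H -> `|Num.sqrt 2 * B t w| <= e) -> ~ S w) ->
  (P S <= (2 * gauss_bound (e / 4) H)%:E)%E.
Proof.
move=> H0 e0 q mS hS.
have hF := dr_filtration hX; have hB := dr_brownian hX.
have e4 : 0 <= e / 4 by rewrite divr_ge0.
have [G [mG PG aG]] := dyadic_sup_bound hF hB H0 e4 q.
have : {ae P, forall w, S w -> G w}.
  near=> w => Sw; apply: contrapT => nG.
  have cB : path_continuous (B ^~ w) by near: w; exact: bm_continuous hB.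
  apply: (hS w) Sw => //.
  - exact: dr_continuous hX w.
  - by move=> t; apply: cvgM; [exact: cvg_cst|exact: cB].
  - by near: w; exact: dr_start hX.
  - have -> : B 0 w = 0 by near: w; exact: bm_start hB.
    by rewrite mulr0.
  - by near: w; exact: dr_domain hX.
  - by near: w; exact: dr_integrable hX.
  - by near: w; exact: dr_sde hX.
  - have bG : forall t, 0 <= t <= H -> `|B t w| <= 2 * (e / 4).
      by move: nG; near: w; exact: aG.
    move=> t tH; rewrite normrM ger0_norm ?sqrtr_ge0//.
    have s2 : Num.sqrt 2 <= 2 :> R.
      by have := sqr_sqrtr (ler0n R 2); have := sqrtr_ge0 (2 : R); nra.
    have := ler_pM (sqrtr_ge0 2) (normr_ge0 (B t w)) s2 (bG t tH).
    lra.
move=> [Z [mZ Z0 SZ]].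
apply: (@le_trans _ _ (P (G `|` Z))).
  apply: le_measure; rewrite ?inE//; first exact: measurableU.
  move=> w Sw; have [Zw|Zw] := pselect (Z w); [by right|left].
  by apply: contrapT => nG; apply: Zw; apply: SZ => /= /(_ Sw).
by rewrite measureU0.
Unshelve. all: by end_near. Qed.

End comparison.

(** * Asymptotics in the dimension *)

Section asymptotics.
Context {R : realType}.

(** ln n tends to infinity. *)
Lemma near_le_ln (M : R) : \forall n \near \oo, M <= ln n%:R.
Proof.
near=> n; rewrite -(expRK M) ler_ln ?posrE ?expR_gt0//.
  apply: (@le_trans _ _ (Num.truncn (expR M)).+1%:R).
    by have /andP[_ /ltW] := truncn_itv (expR_ge0 M).
  by rewrite ler_nat; near: n; exact: nbhs_infty_ge.
by rewrite ltr0n; near: n; exact: nbhs_infty_gt.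
Unshelve. all: by end_near. Qed.

Lemma cvge0_near (f : nat -> \bar R) : (forall n, 0 <= f n)%E ->
  (forall e : R, 0 < e -> \forall n \near \oo, (f n <= e%:E)%E) -> f @ \oo --> 0%E.
Proof.
move=> f0 fe; apply/fine_cvgP; split.
  near=> n; have : (f n <= 1%:E)%E by near: n; exact: fe.
  by move=> /le_lt_trans h; rewrite ge0_fin_numE// h// ltry.
apply/cvgr0Pnorm_le => e e0; near=> n.
have : (f n <= e%:E)%E by near: n; exact: fe.
move=> h; have fn : f n \is a fin_num by rewrite ge0_fin_numE// (le_lt_trans h)// ltry.
by rewrite /= ger0_norm ?fine_ge0// -lee_fin fineK.
Unshelve. all: by end_near. Qed.

Lemma expR_ge_cube (x : R) : 0 <= x -> x ^+ 3 / 6 <= expR x.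
Proof.
move=> x0; apply: le_trans (expR_ge1Dxn 2 x0).
by rewrite /= ler_wpDl.
Qed.

(** The time scale of the cut-off, multiplied by r. *)
Definition log_time (r : R) (n : nat) : R := r * (ln n%:R / n%:R).

(** The level e of the noise that is tolerated.  It is small enough for the
    window of width 4 e around pi/2 to be crossed within the time r ln n / n,
    at speed sqrt n / 6, and large enough, by a factor sqrt (ln n), with
    respect to the size of the noise at times of order ln n / n. *)
Definition noise_level (r : R) (n : nat) : R :=
  r / 24 * ln n%:R / Num.sqrt n%:R.

Lemma sqrt_natE (n : nat) : (0 < n)%N -> Num.sqrt n%:R = expR (ln n%:R / 2) :> R.
Proof.
move=> n0; have n0' : 0 < n%:R :> R by rewrite ltr0n.
have e : expR (ln n%:R / 2) ^+ 2 = n%:R :> R.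
  by rewrite -expRM_natl mulrC divfK// lnK ?posrE.
by rewrite -[in LHS]e sqrtr_sqr ger0_norm ?expR_ge0.
Qed.

Lemma near_gauss_bound_le (r e : R) : 0 < r -> 0 < e ->
  \forall n \near \oo, gauss_bound (noise_level r n / 4) (log_time (1 + r) n) <= e.
Proof.
move=> r0 e0; pose c := (r / 192) ^+ 2 / (1 + r).
have c0 : 0 < c by rewrite !divr_gt0 ?exprn_gt0 ?divr_gt0//; lra.
near=> n.
have n0 : (0 < n)%N by near: n; exact: nbhs_infty_gt.
have n0' : 0 < n%:R :> R by rewrite ltr0n.
have L0 : 1 <= ln n%:R :> R by near: n; exact: near_le_ln.
have Lc : - ln (e / 2) / c <= ln n%:R by near: n; exact: near_le_ln.
rewrite /gauss_bound /noise_level /log_time.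
have s0 : 0 < Num.sqrt n%:R :> R by rewrite sqrtr_gt0.
have s2 : Num.sqrt n%:R ^+ 2 = n%:R :> R by rewrite sqr_sqrtr// ltW.
have -> : (r / 24 * ln n%:R / Num.sqrt n%:R / 4) ^+ 2 /
   (4 * ((1 + r) * (ln n%:R / n%:R))) = c * ln n%:R.
  have {}L0 : 0 < ln n%:R :> R by lra.
  move: (Num.sqrt n%:R) (ln n%:R) s0 s2 L0 => s L s0 s2 L0.
  by rewrite /c -s2; field; rewrite !gt_eqF//; lra.
have q2 : Num.sqrt 2 <= 2 :> R.
  by have := sqr_sqrtr (ler0n R 2); have := sqrtr_ge0 (2 : R); nra.
have : expR (- (c * ln n%:R)) <= e / 2.
  rewrite -[leRHS]lnK ?posrE ?divr_gt0// ler_expR lerNl.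
  by move: Lc; rewrite ler_pdivrMr// [_ * c]mulrC.
move=> /(ler_pM (sqrtr_ge0 _) (expR_ge0 _) q2); lra.
Unshelve. all: by end_near. Qed.

End asymptotics.

Section one_dimension.
Context {R : realType} {d : measure_display} {T : measurableType d}
  (P : probability T R) (F : R -> set (set T)) (B X : R -> T -> R) (n : nat).

Lemma noise_level_gt0 (r : R) : 0 < r -> 0 < ln n%:R :> R -> 0 < noise_level r n.
Proof.
move=> r0 L0; rewrite divr_gt0 ?mulr_gt0 ?divr_gt0// sqrtr_gt0 ltr0n.
by case: n L0 => //; rewrite ln0 ?ltxx.
Qed.

Lemma log_time_gt0 (r : R) : 0 < r -> 0 < ln n%:R :> R -> 0 < log_time r n.
Proof.
move=> r0 L0; rewrite mulr_gt0 ?divr_gt0// ltr0n.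
by case: n L0 => //; rewrite ln0 ?ltxx.
Qed.

(** The phases of approach, crossing and escape last ln n / (2 n), r ln n / n
    and ln n / (2 n). *)
Lemma tau_gt_le (r : R) : (0 < n)%N -> dual_radius n P F B X -> 0 < r ->
  1 <= ln n%:R :> R -> 48 / r <= ln n%:R ->
  gauss_bound (noise_level r n / 4) (log_time (1 + r) n) <= 2^-1 ->
  (P [set w | ((log_time (1 + r) n)%:E < tau X w)%E]
    <= (2 * gauss_bound (noise_level r n / 4) (log_time (1 + r) n))%:E)%E.
Proof.
move=> n0 hX r0 L1 Lr q.
have n0' : 0 < n%:R :> R by rewrite ltr0n.
have s0 : 0 < Num.sqrt n%:R :> R by rewrite sqrtr_gt0.
have s2 : Num.sqrt n%:R ^+ 2 = n%:R :> R by rewrite sqr_sqrtr// ltW.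
have L0 : 0 < ln n%:R :> R by exact: lt_le_trans L1.
have e0 := noise_level_gt0 r r0 L0.
have H0 : 0 < log_time (1 + r) n by apply: log_time_gt0 => //; rewrite addr_gt0.
apply: (dual_radius_bound P F B X n hX) => //; first exact: ltW.
  apply: measurable_hitting_time_gt; first exact: dual_radius_measurable hX.
  exact: dr_continuous hX.
move=> w cX cB X0 B0 dom sint sde ve /=; apply/negP; rewrite -leNgt.
pose tA : R := ln n%:R / (2 * n%:R); pose tB : R := r * (ln n%:R / n%:R).
have tE : log_time (1 + r) n = tA + tB + tA.
  by rewrite /log_time /tA /tB; field; rewrite gt_eqF.
have tA0 : 0 <= tA by rewrite divr_ge0 ?mulr_ge0// ltW.
have tB0 : 0 <= tB by rewrite mulr_ge0 ?divr_ge0// ltW.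
have hA : pi / 2 <= noise_level r n * expR (n%:R * tA).
  have -> : n%:R * tA = ln n%:R / 2 by rewrite /tA; field; rewrite gt_eqF.
  rewrite -sqrt_natE// /noise_level divfK ?gt_eqF//.
  have := pihalf_lt2 R; move: Lr; rewrite ler_pdivrMr//; lra.
have H0t := H0; rewrite tE in H0t ve *.
apply: (path_reaches_pi n (X ^~ w) (fun t => Num.sqrt 2 * B t w) (tau X w)
  (noise_level r n)) => //.
rewrite /noise_level /tB le_eqVlt; apply/orP; left; apply/eqP.
move: (Num.sqrt n%:R) (ln n%:R) s0 s2 => s L s1 <-.
by field; rewrite gt_eqF.
Qed.

(** With d = r / 5 the rate is (1 + r) n, and (1 + r) (1 - r) < 1, so that at
    times before (1 - r) ln n / n the bound of [path_time_ge] involves the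
    factor e^2 n^(1 - r^2), which is of order (ln n)^2 n^(- r^2). *)
Lemma tau_lt_le (r : R) : (0 < n)%N -> dual_radius n P F B X -> 0 < r ->
  1 <= ln n%:R :> R -> r < 1 -> 500 / r ^+ 6 <= ln n%:R ->
  gauss_bound (noise_level r n / 4) (log_time (1 + r) n) <= 2^-1 ->
  (P [set w | (tau X w < (log_time (1 - r) n)%:E)%E]
    <= (2 * gauss_bound (noise_level r n / 4) (log_time (1 + r) n))%:E)%E.
Proof.
move=> n0 hX r0 L1 r1 Lr5 q.
have n0' : 0 < n%:R :> R by rewrite ltr0n.
have s0 : 0 < Num.sqrt n%:R :> R by rewrite sqrtr_gt0.
have s2 : Num.sqrt n%:R ^+ 2 = n%:R :> R by rewrite sqr_sqrtr// ltW.
have L0 : 0 < ln n%:R :> R by exact: lt_le_trans L1.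
have e0 := noise_level_gt0 r r0 L0.
have H0 : 0 < log_time (1 + r) n by apply: log_time_gt0 => //; rewrite addr_gt0.
apply: (dual_radius_bound P F B X n hX) => //; first exact: ltW.
  apply: measurable_hitting_time_lt; first exact: dual_radius_measurable hX.
  exact: dr_continuous hX.
move=> w cX cB X0 B0 dom sint sde ve /=.
have := hitting_time_ge0 pi X w; rewrite -/(tau X w).
case E: (tau X w) => [m| |]//; rewrite lee_fin lte_fin => m0 mlt.
have [t [/andP[t0 tm] Xt]] : exists t, 0 <= t <= m /\ X t w = pi.
  by apply/(hitting_time_le pi X w m cX); rewrite -/(tau X w) E.
have {t t0 tm Xt} Xm : X m w = pi.
  have mt : m <= t by rewrite -lee_fin -E; apply: ereal_inf_lbound; exists t.
  by have -> : m = t by apply/eqP; rewrite eq_le mt tm.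
have Llo : 500 <= ln n%:R * r ^+ 6 by rewrite -ler_pdivrMr// exprn_gt0.
have rp k : 0 < r ^+ k by rewrite exprn_gt0.
have L6 : 500 <= ln n%:R :> R.
  by apply: (le_trans Llo); rewrite ler_piMr ?(ltW L0)// exprn_ile1// ltW.
have r62 : r ^+ 6 <= r ^+ 2 by rewrite ler_wiXn2l ?ltW.
have e2 : noise_level r n ^+ 2 = r ^+ 2 / 576 * ln n%:R ^+ 2 * expR (- ln n%:R).
  rewrite /noise_level expRN lnK ?posrE//.
  move: (Num.sqrt n%:R) (ln n%:R) s0 s2 => s L s1 <-.
  by field; rewrite gt_eqF.
have L2 : 0 < ln n%:R ^+ 2 :> R by rewrite exprn_gt0.
have d01 : 0 < r / 5 <= 1 by lra.
have : (r / 5) ^+ 2 <= 9 * noise_level r n ^+ 2 * expR ((1 + 5 * (r / 5)) * n%:R * m).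
  apply: (path_time_ge n (X ^~ w) (fun t => Num.sqrt 2 * B t w) (tau X w)
    (noise_level r n)) => //.
  - rewrite -(@ltr_sqr _ (3 * _)) ?nnegrE; [|by rewrite mulr_ge0// ltW|by lra].
    rewrite exprMn e2 expRN mulrA ltr_pdivrMr ?expR_gt0//.
    apply: (@lt_le_trans _ _ ((r / 5) ^+ 2 * (ln n%:R ^+ 3 / 6))); last first.
      by rewrite ler_wpM2l ?sqr_ge0// expR_ge_cube// ltW.
    rewrite -subr_gt0.
    have -> : (r / 5) ^+ 2 * (ln n%:R ^+ 3 / 6) - 3 ^+ 2 * (r ^+ 2 / 576 * ln n%:R ^+ 2) =
      r ^+ 2 * ln n%:R ^+ 2 * (ln n%:R / 150 - 64^-1) by field.
    by rewrite mulr_gt0// ?mulr_gt0// subr_gt0; lra.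
  - rewrite ler_pdivrMr; last by rewrite mulr_gt0//; lra.
    have -> : noise_level r n * (r / 5 * Num.sqrt n%:R) = r ^+ 2 / 120 * ln n%:R.
      by rewrite /noise_level; field; rewrite gt_eqF.
    have : ln n%:R * r ^+ 6 <= ln n%:R * r ^+ 2.
      by rewrite ler_wpM2l ?(ltW L0)// r62.
    by lra.
  - move=> t /andP[t0 tm]; apply: ve; rewrite t0/= (le_trans tm)// ltW//.
    apply: (lt_le_trans mlt); rewrite /log_time ler_wpM2r//; last lra.
    by rewrite divr_ge0 ?ltW.
apply/negP; rewrite -ltNge e2.
have nm : n%:R * m < (1 - r) * ln n%:R.
  by move: mlt; rewrite /log_time mulrA ltr_pdivlMr// mulrC.
set E1 := expR (_ * m); set E2 := expR (- _).
have E12 : E2 * E1 <= expR (- (r ^+ 2 * ln n%:R)).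
  rewrite /E2 /E1 -expRD ler_expR.
  have : (1 + r) * (n%:R * m) <= (1 + r) * ((1 - r) * ln n%:R).
    by rewrite ler_wpM2l ?(ltW nm)//; lra.
  have -> : (1 + 5 * (r / 5)) * n%:R * m = (1 + r) * (n%:R * m) by field.
  lra.
have E3 : ln n%:R ^+ 2 * (E2 * E1) <= 80^-1.
  apply: (@le_trans _ _ (ln n%:R ^+ 2 * expR (- (r ^+ 2 * ln n%:R)))).
    by rewrite (ler_wpM2l (ltW L2) E12).
  rewrite expRN ler_pdivrMr ?expR_gt0//.
  have cube := expR_ge_cube _ (mulr_ge0 (ltW (rp 2%N)) (ltW L0)).
  have h : ln n%:R ^+ 2 * 500 <= ln n%:R ^+ 2 * (ln n%:R * r ^+ 6).
    exact: (ler_wpM2l (ltW L2) Llo).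
  have e3 : (r ^+ 2 * ln n%:R) ^+ 3 = ln n%:R ^+ 2 * (ln n%:R * r ^+ 6) by ring.
  rewrite e3 in cube; move: (expR _) cube => E4; lra.
have -> : 9 * (r ^+ 2 / 576 * ln n%:R ^+ 2 * E2) * E1 =
  r ^+ 2 * (ln n%:R ^+ 2 * (E2 * E1) / 64) by field.
have -> : (r / 5) ^+ 2 = r ^+ 2 * 25^-1 by field.
by rewrite ltr_pM2l//; lra.
Qed.

End one_dimension.

Theorem theorem3 (R : realType) (d : nat -> measure_display)
  (T : forall n : nat, measurableType (d n))
  (P : forall n : nat, probability (T n) R)
  (F : forall n : nat, R -> set (set (T n)))
  (B X : forall n : nat, R -> T n -> R)
  (hX : forall n : nat, (1 <= n)%N ->
    dual_radius n (P n) (F n) (B n) (X n))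
  (r : R) (hr : 0 < r) :
  ((fun n : nat =>
      P n [set w | (((1 + r) * (ln n%:R / n%:R))%:E < tau (X n) w)%E])
     @ \oo --> 0%E) /\
  ((fun n : nat =>
      P n [set w | (tau (X n) w < ((1 - r) * (ln n%:R / n%:R))%:E)%E])
     @ \oo --> 0%E).
Proof.
split; apply: cvge0_near => // e e0.
- near=> n; apply: (@le_trans _ _
    (2 * gauss_bound (noise_level r n / 4) (log_time (1 + r) n))%:E).
    apply: tau_gt_le => //.
    + by near: n; exact: nbhs_infty_gt.
    + by apply: hX; near: n; exact: nbhs_infty_gt.
    + by near: n; exact: near_le_ln.
    + by near: n; exact: near_le_ln.
    + by near: n; exact: near_gauss_bound_le.
  rewrite lee_fin -ler_pdivlMl// [2^-1 * e]mulrC.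
  by near: n; apply: near_gauss_bound_le => //; rewrite divr_gt0.
- have [r1|r1] := ltP r 1; last first.
    apply: nearW => n; rewrite [X in P n X](_ : _ = set0).
      by rewrite measure0 lee_fin ltW.
    apply/seteqP; split => // w /=.
    move=> /(le_lt_trans (hitting_time_ge0 pi (X n) w)); rewrite lte_fin.
    rewrite ltNge mulr_le0_ge0 ?subr_le0// divr_ge0//.
    by case: n {w} => [|n]; [rewrite ln0|rewrite ln_ge0// ler1n].
  near=> n; apply: (@le_trans _ _
    (2 * gauss_bound (noise_level r n / 4) (log_time (1 + r) n))%:E).
    apply: tau_lt_le => //.
    + by near: n; exact: nbhs_infty_gt.
    + by apply: hX; near: n; exact: nbhs_infty_gt.
    + by near: n; exact: near_le_ln.
    + by near: n; exact: near_le_ln.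
    + by near: n; exact: near_gauss_bound_le.
  rewrite lee_fin -ler_pdivlMl// [2^-1 * e]mulrC.
  by near: n; apply: near_gauss_bound_le => //; rewrite divr_gt0.
Unshelve. all: by end_near. Qed.
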